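(* Let $\mathbf m=(m_1,\dots,m_n)$ be positive integers, $M=\sum_i m_i$, $M_i=\sum_{k=1}^i m_k$ ($M_0=0$), and let $\beta\in S_M$ be the permutation whose one-line notation lists $M_0+1,M_1+1,\dots,M_{n-1}+1$, then $M_{n-1}+2,\dots,M_n$ in increasing order, then $M_{n-2}+2,\dots,M_{n-1}$ in increasing order, and so on, ending with $2,\dots,M_1$. For $i\in[M]$ let $r_i(\beta)=\#\{j<i\mid \beta_j>\beta_i\}$, and let $\lambda$ be the partition (Ferrers diagram) whose parts are the positive values among $r_1(\beta),\dots,r_M(\beta)$ (with multiplicity), arranged in decreasing order. Then the number of maximal chains in $\mathbf{BL}(\mathbf m)$ is \[\frac{|\lambda|!}{\prod_{(i,j)\in\lambda}h_{i,j}},\] where $h_{i,j}$ is the hook length of the cell $(i,j)$ of $\lambda$, i.e. the number of cells $(k,l)\in\lambda$ with either $k=i,\ l\ge j$ or $l=j,\ k\ge i$.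
   Context: $\mathbf{BL}(\mathbf m)$ is the set of words of the multiset with $m_i$ copies of $i$ ($i\in[n]$) in which, for each $i\in[n-1]$, the first occurrence of $i$ precedes the first occurrence of $i+1$, partially ordered by the reflexive-transitive closure of: $s\lessdot t$ iff $t$ arises from $s$ by swapping two adjacent entries $a<b$ appearing as $ab$ in $s$. A maximal chain is a chain from the minimum to the maximum element in which each step is a cover. *)

(* Defs.v *)
From mathcomp Require Import all_boot all_fingroup all_algebra.

Set Implicit Arguments.
Unset Strict Implicit.
Unset Printing Implicit Defensive.

Section FinitePosets.
Variables (T : finType) (le : rel T).

Definition strict : rel T := fun x y => (x != y) && le x y.

Definition covered_by : rel T := fun x y =>
  strict x y && ~~ [exists z, strict x z && strict z y].

Definition is_minimum (x : T) : bool := [forall y, le x y].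
Definition is_maximum (x : T) : bool := [forall y, le y x].

(* A chain x_0 < ... < x_k is encoded by its set of elements.  The last clause
   says that any two consecutive elements of C form a cover of the whole
   poset T. *)
Definition maximal_chain (C : {set T}) : bool :=
  [&& [forall x in C, forall y in C, le x y || le y x],
      [exists x in C, is_minimum x],
      [exists x in C, is_maximum x]
    & [forall x in C, forall y in C,
        strict x y && ~~ [exists z in C, strict x z && strict z y]
          ==> covered_by x y]].

End FinitePosets.

(* The letters 1, ..., n are encoded by 'I_n = {0, ..., n - 1}. *)
Section BL.
Variables (n : nat) (m : 'I_n -> nat).

Definition mult_size : nat := \sum_i m i.

Definition word : finType := (mult_size.-tuple 'I_n)%type.

Definition is_BL (w : word) : bool :=
  [forall i : 'I_n, count_mem i w == m i] &&
  [forall i : 'I_n, forall j : 'I_n,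
    (j == i.+1 :> nat) ==> (index i w < index j w)].

Definition BL : finType := {w : word | is_BL w}.

Definition BL_step : rel BL := fun s t =>
  [exists p : 'I_mult_size, exists q : 'I_mult_size,
    [&& q == p.+1 :> nat,
        tnth (val s) p < tnth (val s) q
      & val t == [tuple tnth (val s) (tperm p q k) | k < mult_size]]].

Definition BL_le : rel BL := connect BL_step.

(* M_k = m_1 + ... + m_k. *)
Definition psum (k : nat) : nat := \sum_(i < n | i < k) m i.

(* The one-line notation of beta, with every value lowered by 1 so that it
   lists 0, ..., mult_size - 1: the i-th block {M_(i-1) + 1, ..., M_i} becomes
   {psum i, ..., psum i + m i - 1} for i : 'I_n. *)
Definition beta_line : seq nat :=
  [seq psum i | i : 'I_n] ++
  flatten [seq iota (psum i).+1 (m i).-1 | i : 'I_n <- rev (enum 'I_n)].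

End BL.

Section Beta.
Variables (n : nat) (m : 'I_n -> nat) (m_gt0 : forall i, 0 < m i).

Lemma psumS (i : 'I_n) : psum m i.+1 = psum m i + m i.
Proof.
rewrite /psum (bigD1 i) //= addnC; congr (_ + _).
by apply: eq_bigl => j; rewrite ltnS andbC ltn_neqAle.
Qed.

Lemma psum_size : psum m n = mult_size m.
Proof. by apply: eq_bigl => i; rewrite ltn_ord. Qed.

Lemma size_beta_line : size (beta_line m) = mult_size m.
Proof.
rewrite /beta_line size_cat size_map size_flatten /shape -map_comp.
rewrite sumnE big_map big_rev /= big_enum /= -cardE -sum1_card.
by rewrite -big_split /=; apply: eq_bigr => i _; rewrite size_iota add1n prednK.
Qed.

Lemma mem_beta_line_sub : {subset iota 0 (mult_size m) <= beta_line m}.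
Proof.
move=> v; rewrite mem_iota add0n -psum_size => /= ltv.
have exk : exists k, v < psum m k by exists n.
case: (ex_minnP exk) => -[|k] ltvk mink.
  by move: ltvk; rewrite /psum big_pred0.
have ltkn : k < n by exact: mink ltv.
pose i := Ordinal ltkn.
have lekv : psum m i <= v.
  by rewrite leqNgt; apply/negP => /mink; rewrite ltnn.
have {}ltvk : v < psum m i + m i by rewrite -psumS.
rewrite mem_cat; case: (ltngtP (psum m i) v) lekv => // [ltiv|<-] _; apply/orP.
  right; apply/flattenP; exists (iota (psum m i).+1 (m i).-1).
    by apply: map_f; rewrite mem_rev mem_enum.
  by rewrite mem_iota ltiv addSnnS prednK.
by left; apply: map_f; rewrite mem_enum.
Qed.

Lemma beta_line_perm : perm_eq (beta_line m) (iota 0 (mult_size m)).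
Proof.
have Usz : size (beta_line m) <= size (iota 0 (mult_size m)).
  by rewrite size_iota size_beta_line.
have [_ Eq] := uniq_min_size (iota_uniq 0 (mult_size m)) mem_beta_line_sub Usz.
rewrite perm_sym; apply: uniq_perm => //; first exact: iota_uniq.
exact: leq_size_uniq (iota_uniq 0 (mult_size m)) mem_beta_line_sub Usz.
Qed.

Lemma beta_line_lt (i : 'I_(mult_size m)) : nth 0 (beta_line m) i < mult_size m.
Proof.
have: nth 0 (beta_line m) i \in iota 0 (mult_size m).
  by rewrite -(perm_mem beta_line_perm) mem_nth ?size_beta_line.
by rewrite mem_iota.
Qed.

Definition beta_fun (i : 'I_(mult_size m)) : 'I_(mult_size m) :=
  Ordinal (beta_line_lt i).

Lemma beta_fun_inj : injective beta_fun.
Proof.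
move=> i j /(congr1 val) /= /eqP; rewrite nth_uniq ?size_beta_line //.
  by move/eqP/val_inj.
by rewrite (perm_uniq beta_line_perm) iota_uniq.
Qed.

Definition beta : 'S_(mult_size m) := perm beta_fun_inj.

End Beta.

Definition inv_code N (s : 'S_N) (i : 'I_N) : nat :=
  #|[set j : 'I_N | (j < i) && (s i < s j)]|.

Definition code_partition N (s : 'S_N) : seq nat :=
  sort geq [seq r <- [seq inv_code s i | i : 'I_N] | 0 < r].

(* Cells are indexed from 0: row i holds the cells (i, 0), ..., (i, la_i - 1). *)
Definition cells (la : seq nat) : seq (nat * nat) :=
  [seq (i, j) | i <- iota 0 (size la), j <- iota 0 (nth 0 la i)].

Definition hook_length (la : seq nat) (c : nat * nat) : nat :=
  count (fun d : nat * nat =>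
           ((d.1 == c.1) && (c.2 <= d.2)) || ((d.2 == c.2) && (c.1 <= d.1)))
        (cells la).

(* Main.v *)
Require Import Defs.
From mathcomp Require Import all_boot all_fingroup all_algebra.
From mathcomp Require Import zify ring.

(* Numbering the copies of each letter turns BL(m) into the interval [1, beta] of
   the weak order, so maximal chains are the saturated walks from beta down to
   the identity by descents at adjacent positions.

   Let phi_n(w) count the walks of length n from w to 1.  The operator "apply an
   adjacent descent in all possible ways" commutes with the signed operator
   that, for a fixed value v, sums over the Bruhat covers of w exchanging v
   with another value, the sign telling whether v is the smaller one: the only
   terms that do not match are those where the two moves coincide, and these
   add up to w - w.  Hence phi_n kills the signed sum of covers, which is the
   transition formula of Lascoux and Schuetzenberger for the number of reduced
   words.

   The permutation beta avoids the pattern 213; equivalently, its inversion code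
   is weakly increasing.  For such a w with a descent at (j-1, j), one instance
   of the transition formula has only two terms and says that w s_(j-1) has as
   many walks as the 213-avoiding permutation whose code is that of w with the
   j-th entry lowered by 1.  So the number of walks satisfies the recursion
   f(c) = sum_j f(c - e_j) of standard Young tableaux.  With l_i = c_i + i, it is
   solved by Frobenius' formula |c|! prod_(i<j) (l_j - l_i) / prod_i l_i!, which
   becomes the hook formula row by row. *)

Set Implicit Arguments.
Unset Strict Implicit.
Unset Printing Implicit Defensive.

Import GRing.Theory Num.Theory.

(** * Hook products *)

Section HookProduct.

(* The product of the hook lengths of a row of length r lying above rows with
   lengths s. *)
Definition row_hooks (r : nat) (s : seq nat) : nat :=
  \prod_(j < r) (r - j + count (fun x => j < x) s).

Fixpoint hook_product (la : seq nat) : nat :=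
  if la is r :: la' then row_hooks r la' * hook_product la' else 1.

Lemma row_hooks_nil r : row_hooks r [::] = r`!.
Proof.
elim: r => [|r IHr]; first by rewrite /row_hooks big_ord0.
by rewrite factS -IHr /row_hooks big_ord_recl subn0 addn0; congr (_ * _).
Qed.

(* Here s lists the rows below from the shortest to the longest.  Either the
   shortest one is empty and can be dropped, or all rows meet the first column,
   which can be removed. *)
Lemma row_hooksE (r : nat) (s : seq nat) :
    sorted leq s -> all (fun x => x <= r) s ->
  row_hooks r s * \prod_(k < size s) (r + size s - (nth 0 s k + k))
    = (r + size s)`!.
Proof.
elim: r s => [|r IHr]; elim=> [|x s IHs].
- by rewrite row_hooks_nil big_ord0.
- move=> /= srt /andP[]; rewrite leqn0 => /eqP x0 /IHs{}IHs.
  rewrite big_ord_recl /= x0 subn0 addnS factS mulnCA; congr (_ * _).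
  rewrite -IHs ?(path_sorted srt) //; congr (_ * _).
  by apply: eq_bigr => k _; rewrite add0n /bump leq0n addnCA subSS.
- by rewrite row_hooks_nil big_ord0 muln1 addn0.
move=> /= srt /andP[le_xr les].
have minx: all (leq x) s by rewrite order_path_min //; apply: leq_trans.
case: x srt le_xr minx => [|x] srt le_xr minx.
  rewrite big_ord_recl /= subn0 addnS factS mulnCA; congr (_ * _).
  rewrite -(IHs (path_sorted srt) les); congr (_ * _).
  by apply: eq_bigr => k _; rewrite add0n /bump leq0n addnCA subSS.
set t := x.+1 :: s.
have st_gt0 : all (fun y => 0 < y) t.
  by rewrite /t /=; apply: sub_all minx => y; lia.
have szt : size t = (size s).+1 by [].
have := IHr (map predn t).
have -> : sorted leq (map predn t).
  rewrite sorted_map; apply: (@sub_sorted _ leq _ _ t srt) => y z /=; lia.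
have -> : all (leq^~ r) (map predn t).
  rewrite all_map; apply/allP => y.
  rewrite inE => /orP[/eqP->|/(allP les)] /=; lia.
move=> /(_ isT isT); rewrite size_map szt addSn factS => <-.
rewrite /row_hooks big_ord_recl subn0 -!mulnA; congr (_ * _).
  have /eqP-> : count (fun y => 0 < y) t == size t by rewrite -all_count.
  by rewrite szt addSn.
congr (_ * _).
  apply: eq_bigr => j _; rewrite count_map lift0 subSS; congr (_ + _).
  by apply: eq_count => y /=; lia.
apply: eq_bigr => k _; rewrite (nth_map 0) //.
have /(allP st_gt0) : nth 0 t k \in t by rewrite mem_nth.
lia.
Qed.

(** An empty row has the empty product as its hooks, and it never meets a column, so it adds nothing
    to the legs of the longer rows. *)
Lemma hook_product_rev_pos (cs : seq nat) :
  hook_product (rev [seq r <- cs | 0 < r]) = hook_product (rev cs).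
Proof.
elim/last_ind: cs => // cs r IH; rewrite filter_rcons.
case: r => [|r] /=; rewrite ?rev_rcons /=.
  by rewrite IH /row_hooks big_ord0 mul1n.
rewrite IH; congr (_ * _); apply: eq_bigr => j _; congr (_ + _).
rewrite !count_rev count_filter; apply: eq_count => x /=; lia.
Qed.

Lemma row_hooks_rev r s : row_hooks r (rev s) = row_hooks r s.
Proof. by apply: eq_bigr => j _; rewrite count_rev. Qed.

(** Induction that appends the longest row: by [row_hooksE], its hooks times its differences with
    the earlier shifted parts give the new factorial. *)
Lemma hook_product_Vandermonde (cs : seq nat) : sorted leq cs ->
  hook_product (rev cs) *
    \prod_(k < size cs) \prod_(i < k) (nth 0 cs k + k - (nth 0 cs i + i))
  = \prod_(k < size cs) (nth 0 cs k + k)`!.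
Proof.
elim/last_ind: cs => [|cs r IH] srt; first by rewrite !big_ord0.
have /andP[ler srt'] : all (leq^~ r) cs && sorted leq cs.
  move: srt; rewrite -[sorted _ _]rev_sorted rev_rcons /=.
  rewrite (path_sortedE (fun _ _ _ h1 h2 => leq_trans h2 h1)) all_rev.
  by rewrite rev_sorted.
rewrite size_rcons !big_ord_recr /= rev_rcons /= row_hooks_rev nth_rcons ltnn eqxx.
rewrite -(row_hooksE srt' ler).
under [\prod_(k < _) \prod_(i < _) _]eq_bigr => k _.
  under eq_bigr => i _ do rewrite !nth_rcons ltn_ord (ltn_trans (ltn_ord i) (ltn_ord k)).
  over.
have -> : \prod_(i < size cs) (r + size cs - (nth 0 (rcons cs r) i + i))
    = \prod_(i < size cs) (r + size cs - (nth 0 cs i + i)).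
  by apply: eq_bigr => k _; rewrite nth_rcons ltn_ord.
have -> : \prod_(i < size cs) (nth 0 (rcons cs r) i + i)`!
    = \prod_(i < size cs) (nth 0 cs i + i)`!.
  by apply: eq_bigr => k _; rewrite nth_rcons ltn_ord.
by rewrite -IH //; ring.
Qed.

(** The first summand is the arm together with the cell itself; the leg has one cell for each lower
    row that reaches column j. *)
Lemma hook_lengthE (la : seq nat) i j : i < size la -> j < nth 0 la i ->
  hook_length la (i, j)
    = nth 0 la i - j + count (fun x => j < x) (drop i.+1 la).
Proof.
move=> lti ltj; rewrite /hook_length -sum1_count big_mkcond big_allpairs_dep /=.
have -> : count (fun x => j < x) (drop i.+1 la)
    = \sum_(i.+1 <= k < size la) (j < nth 0 la k).
  rewrite -sum1_count -[X in drop _ X](mkseq_nth 0 la) /mkseq -map_drop drop_iota.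
  by rewrite big_map [LHS]big_mkcond /index_iota.
rewrite -[in LHS](subn0 (size la)) -/(index_iota 0 (size la)).
rewrite (big_cat_nat (n := i)) //=; last exact: ltnW.
rewrite big_nat big1 ?add0n => [|k /andP[_ ltk]]; last first.
  by rewrite big1 // => l _; rewrite ltn_eqF //= leqNgt ltk andbF.
rewrite big_ltn //; congr (_ + _).
  rewrite -[X in iota 0 X](subn0 (nth 0 la i)) -/(index_iota 0 (nth 0 la i)).
  rewrite (big_cat_nat (n := j)) //=; last exact: ltnW.
  rewrite big_nat big1 => [|l /andP[_ ltl]]; last first.
    by rewrite eqxx leqnn /= leqNgt ltl ltn_eqF.
  rewrite big_nat -[RHS]muln1 -sum_nat_const_nat add0n [RHS]big_nat.
  by apply: eq_bigr => l /andP[lel _]; rewrite eqxx lel.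
apply: eq_big_nat => k /andP[ltk _].
rewrite -big_mkcond /= -[RHS]/(nat_of_bool _) sum1_count.
rewrite (eq_count (a2 := pred1 j)) => [|l]; last first.
  by rewrite /= gtn_eqF // (ltnW ltk) andbT.
by rewrite count_uniq_mem ?iota_uniq // mem_iota.
Qed.

Lemma prod_hook_length (la : seq nat) :
  \prod_(c <- cells la) hook_length la c = hook_product la.
Proof.
have -> : hook_product la
    = \prod_(0 <= i < size la) row_hooks (nth 0 la i) (drop i.+1 la).
  elim: la => [|r la IH] /=; first by rewrite big_geq.
  by rewrite big_nat_recl //= drop0 IH.
rewrite big_allpairs_dep /= -[X in iota _ X](subn0 (size la)).
rewrite !big_nat; apply: eq_bigr => i /andP[_ lti].
rewrite /row_hooks -[X in iota _ X](subn0 (nth 0 la i)) big_mkord.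
by apply: eq_bigr => j _; rewrite hook_lengthE.
Qed.

End HookProduct.

(** * The recursion for standard Young tableaux *)

Section Falling.
Local Open Scope ring_scope.

(* In the Leibniz expansion the i-th summand multiplies the term of s by
   x i - y (s i), and the y's sum up to a quantity independent of s. *)
Lemma sum_det_row_scale (R : comPzRingType) n (A : 'M[R]_n) (x y : 'I_n -> R) :
  \sum_i \det (\matrix_(k, j) (A k j * (if k == i then x k - y j else 1)))
    = (\sum_i x i - \sum_i y i) * \det A.
Proof.
rewrite /determinant exchange_big big_distrr /=; apply: eq_bigr => s _.
rewrite mulrCA -big_distrr /=; congr (_ * _).
rewrite [\sum_i y i](reindex_inj (@perm_inj _ s)) -sumrB big_distrl /=.
apply: eq_bigr => i _.
under eq_bigr => k _ do rewrite mxE.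
rewrite big_split mulrC; congr (_ * _).
by rewrite (bigD1 i) //= eqxx big1 ?mulr1 // => k /negPf->.
Qed.

Definition ffact_det n (l : 'I_n -> nat) : rat :=
  \det (\matrix_(i < n, j < n) (l i ^_ j)%:R).

Definition decr n (l : 'I_n -> nat) (i : 'I_n) : 'I_n -> nat :=
  fun k => (l k - (k == i))%N.

(** Instance of [sum_det_row_scale] with [x = l] and the column index as [y]: the factor [l i] turns
    the lowered row into the original one, its entry in column j scaled by [l i - j]. *)
Lemma ffact_det_decr n (l : 'I_n -> nat) :
  \sum_i (l i)%:R * ffact_det (decr l i)
    = ((\sum_i l i)%:R - (\sum_(i < n) i)%:R) * ffact_det l.
Proof.
rewrite !natr_sum -sum_det_row_scale; apply: eq_bigr => i _.
rewrite /determinant big_distrr /=; apply: eq_bigr => s _.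
rewrite mulrCA; congr (_ * _).
under [in RHS]eq_bigr => k _ do rewrite !mxE.
rewrite [RHS]big_split /= [X in _ = _ * X](bigD1 i) //= eqxx.
rewrite [X in _ = _ * (_ * X)]big1 ?mulr1 => [|k /negPf-> //].
rewrite (bigD1 i) //= [X in _ = X * _](bigD1 i) //= !mxE /decr eqxx subn1.
rewrite mulrA -natrM -ffactnS ffactnSr.
rewrite mulrAC; congr (_ * _); last first.
  by apply: eq_bigr => k /negPf ki; rewrite mxE ki subn0.
case: (leqP (s i) (l i)) => les; first by rewrite natrM natrB.
by rewrite (ffact_small les) !mul0r.
Qed.

(** The falling factorial of order j is a monic polynomial of degree j, so the matrix is a
    transposed Vandermonde matrix times a unitriangular one. *)
Lemma ffact_det_prod n (l : 'I_n -> nat) :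
  ffact_det l = \prod_(i < n) \prod_(j < n | (i < j)%N) ((l j)%:R - (l i)%:R).
Proof.
pose p (j : 'I_n) : {poly rat} := \prod_(i < j) ('X - i%:R%:P).
have sz_p j : size (p j) = j.+1.
  by rewrite /p -big_enum /= size_prod_XsubC size_enum_ord.
have pE (j : 'I_n) i : (l i ^_ j)%:R = (p j).[(l i)%:R].
  rewrite /p; move: (nat_of_ord j) => k; rewrite horner_prod.
  elim: k => [|k IH]; first by rewrite ffactn0 big_ord0.
  rewrite big_ord_recr /= -IH ffactnSr !hornerE.
  case: (leqP k (l i)) => lek; first by rewrite natrM natrB.
  by rewrite (ffact_small lek) !mul0r.
pose U := \matrix_(k < n, j < n) (p j)`_k.
pose a : 'rV[rat]_n := \row_i (l i)%:R.
have -> : ffact_det l = \det ((Vandermonde n a)^T *m U).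
  congr (\det _); apply/matrixP => i j; rewrite !mxE pE.
  rewrite (horner_coef_wide (n := n)) ?sz_p //.
  by apply: eq_bigr => k _; rewrite !mxE mulrC.
rewrite det_mulmx det_tr det_Vandermonde -[\det U]det_tr det_trig; last first.
  by apply/is_trig_mxP => i j ltij; rewrite !mxE nth_default ?sz_p.
rewrite [X in _ * X]big1 ?mulr1 => [|i _].
  by apply: eq_bigr => i _; apply: eq_bigr => j _; rewrite !mxE.
rewrite !mxE; have /monicP <- : p i \is monic by exact: monic_prod_XsubC.
by rewrite lead_coefE sz_p.
Qed.

(* Frobenius' formula for the number of standard tableaux, for parts c i in
   increasing order; zero parts do not change its value. *)
Definition code_count n (c : 'I_n -> nat) : rat :=
  (\sum_i c i)`!%:R * ffact_det (fun i => c i + i)%N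
    / (\prod_(i < n) (c i + i)`!)%:R.

(** Here [l i = i], so the matrix is triangular and its diagonal entries [i!] cancel the
    denominator. *)
Lemma code_count0 n (c : 'I_n -> nat) : \sum_i c i = 0%N -> code_count c = 1.
Proof.
move=> /eqP; rewrite sum_nat_eq0 => /forallP c0.
have {}c0 i : c i = 0%N by apply/eqP/(implyP (c0 i)).
rewrite /code_count big1 // fact0 mul1r /ffact_det det_trig.
  rewrite natr_prod -prodf_div big1 // => i _.
  by rewrite mxE c0 ffactnn divff // pnatr_eq0 -lt0n fact_gt0.
by apply/is_trig_mxP => i j ltij; rewrite mxE c0 ffact_small.
Qed.

Lemma sum_decr n (c : 'I_n -> nat) j : (0 < c j)%N ->
  (\sum_i decr c j i = (\sum_i c i).-1)%N.
Proof.
rewrite (bigD1 j) //= /decr eqxx [in RHS](bigD1 j) //= subn1.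
case: (c j) => // k _ /=; congr (_ + _)%N.
by apply: eq_bigr => i /negPf->; rewrite subn0.
Qed.

Lemma eq_code_count n (c d : 'I_n -> nat) : c =1 d -> code_count c = code_count d.
Proof.
move=> cd; rewrite /code_count (eq_bigr d) //; congr (_ * \det _ / _%:R).
  by apply/matrixP => i j; rewrite !mxE cd.
by apply: eq_bigr => i _; rewrite cd.
Qed.

(** [S] plays the part of the removable corners. The sum extends to all j with vanishing terms, and
    [ffact_det_decr] then evaluates it as [\sum_i c i] times the determinant. *)
Lemma code_count_rec n (c : 'I_n -> nat) (S : pred 'I_n) :
    (0 < \sum_i c i)%N ->
    (forall j, S j -> 0 < c j)%N ->
    (forall j, ~~ S j -> c j + j = 0 \/
       exists2 i : 'I_n, j = i.+1 :> nat & c i = c j)%N ->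
  code_count c = \sum_(j | S j) code_count (decr c j).
Proof.
set l := fun i => (c i + i)%N => c_gt0 S_gt0 notS.
pose X : rat := (\prod_(i < n) (l i)`!)%:R.
have F0 : X != 0 by rewrite pnatr_eq0 -lt0n prodn_gt0 // => i; exact: fact_gt0.
have term j : S j -> code_count (decr c j)
    = ((\sum_i c i).-1)`!%:R * ((l j)%:R * ffact_det (decr l j)) / X.
  move=> Sj; rewrite /code_count sum_decr ?S_gt0 //.
  have -> : ffact_det (fun i => decr c j i + i)%N = ffact_det (decr l j).
    congr (\det _); apply/matrixP => i k; rewrite !mxE; congr (_ ^_ _)%:R.
    rewrite /decr /l; case: eqP => [->|_]; last by rewrite !subn0.
    by have := S_gt0 _ Sj; lia.
  have -> : X = (l j)%:R * (\prod_(i < n) (decr c j i + i)`!)%:R.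
    rewrite /X -natrM; congr _%:R; rewrite (bigD1 j) //= [in RHS](bigD1 j) //= mulnA.
    congr (_ * _)%N; last by apply: eq_bigr => i /negPf ij; rewrite /decr ij subn0.
    rewrite /l /decr eqxx; have := S_gt0 _ Sj; case: (c j) => // k _.
    by rewrite subn1 addSn factS.
  have lj0 : (l j)%:R != 0 :> rat.
    by rewrite pnatr_eq0 /l -lt0n ltn_addr // S_gt0.
  have Y0 : (\prod_(i < n) (decr c j i + i)`!)%:R != 0 :> rat.
    by rewrite pnatr_eq0 -lt0n prodn_gt0 // => i; exact: fact_gt0.
  by field; rewrite lj0 Y0.
rewrite (eq_bigr _ term) -big_distrl -big_distrr /= /code_count -/X -/l.
congr (_ / _).
have -> : \sum_(j | S j) (l j)%:R * ffact_det (decr l j)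
    = \sum_j (l j)%:R * ffact_det (decr l j).
  (* Outside [S], either the factor [l j] is zero, or lowering [l j] makes it equal to [l i] for the
     preceding i, and two rows coincide. *)
  rewrite [RHS](bigID S) /= [X in _ = _ + X]big1 ?addr0 // => j nSj.
  case: (notS j nSj) => [lj0|[i ij cij]]; first by rewrite /l lj0 mul0r.
  rewrite /ffact_det (determinant_alternate (i1 := i) (i2 := j)) ?mulr0 //.
    by apply/eqP => eij; move: ij; rewrite eij; lia.
  move=> k; rewrite !mxE /decr /l eqxx cij ij.
  have /negPf-> : i != j by apply/eqP => eij; move: ij; rewrite eij; lia.
  by congr (_ ^_ _)%:R; lia.
rewrite ffact_det_decr /l big_split natrD addrK mulrA -natrM mulnC.
by case: (\sum_i c i)%N c_gt0.
Qed.

End Falling.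

(** * The transition formula *)

Section Walks.
Variable N : nat.
Implicit Types (w : 'S_N) (i j p q : 'I_N).

Definition descent w (ij : 'I_N * 'I_N) : bool :=
  (ij.2 == ij.1.+1 :> nat) && (w ij.2 < w ij.1).

Fixpoint num_walks (n : nat) (w : 'S_N) : nat :=
  if n is n'.+1 then
    \sum_(ij | descent w ij) num_walks n' (tperm ij.1 ij.2 * w)%g
  else (w == 1%g).

(* Exchanging the values at positions p < q yields a cover of w in the Bruhat
   order. *)
Definition bruhat_cover w p q : bool :=
  [&& p < q, w p < w q & [forall c : 'I_N, (p < c < q) ==> ~~ (w p < w c < w q)]].

Lemma val_tperm i j p :
  tperm i j p
    = (if p == i :> nat then j : nat else if p == j :> nat then i else p) :> nat.
Proof.
case: (tpermP i j p) => [->|->|pi pj]; first by rewrite eqxx.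
  by rewrite eqxx; case: eqP.
by do 2![case: eqP => [/val_inj //|_]].
Qed.

Lemma val_neq w p q : p <> q :> nat -> w p <> w q :> nat.
Proof. by move=> neq /val_inj/perm_inj epq; apply: neq; rewrite epq. Qed.

Lemma ord_neq n (i j : 'I_n) : i <> j -> i <> j :> nat.
Proof. by move=> neq /val_inj. Qed.

Lemma ltn_tperm_adj i j p q : j = i.+1 :> nat ->
    ~ (p = i :> nat /\ q = j :> nat) -> ~ (p = j :> nat /\ q = i :> nat) ->
  (tperm i j p < tperm i j q) = (p < q).
Proof. move=> ij H1 H2; rewrite !val_tperm; repeat case: ifP => ?; lia. Qed.

Lemma bruhat_coverP w p q :
  reflect [/\ p < q, w p < w q &
             forall c : 'I_N, p < c -> c < q -> w p < w c -> w q <= w c]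
          (bruhat_cover w p q).
Proof.
apply: (iffP and3P) => -[pq wpq /= between]; split=> //.
  move=> c pc cq wpc; have /forallP/(_ c) := between.
  by rewrite pc cq wpc /= -leqNgt.
apply/forallP=> c; apply/implyP=> /andP[pc cq].
by rewrite negb_and -!leqNgt -implyNb -ltnNge; apply/implyP; apply: between.
Qed.

(** Expresses a cover after the move [s] through the values of w itself, so that only the order of
    the positions differs from [bruhat_coverP]. *)
Lemma bruhat_cover_mulP w i j p q : let s := tperm i j in
  reflect [/\ s p < s q, w p < w q &
             forall c : 'I_N, s p < s c -> s c < s q -> w p < w c -> w q <= w c]
          (bruhat_cover (s * w)%g (s p) (s q)).
Proof.
move=> s; apply: (iffP (bruhat_coverP _ _ _)); rewrite !permM !tpermK;
  move=> -[h1 h2 h3]; split=> // c pc cq.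
  by have := h3 (s c) pc cq; rewrite permM tpermK.
by rewrite permM; apply: h3; rewrite /s tpermK.
Qed.

Lemma ltn_tperm_adjW i j p q : j = i.+1 :> nat ->
  tperm i j p < tperm i j q -> p < q \/ p = j /\ q = i.
Proof.
move=> ij lts; have: p < q \/ p = j :> nat /\ q = i :> nat.
  by move: lts; rewrite !val_tperm; repeat case: ifP => ?; lia.
by case=> [|[/val_inj-> /val_inj->]]; [left|right].
Qed.

Lemma ltn_tperm_adjV i j p q : j = i.+1 :> nat ->
  p < q -> tperm i j p < tperm i j q \/ p = i /\ q = j.
Proof.
move=> ij lts; have: tperm i j p < tperm i j q \/ p = i :> nat /\ q = j :> nat.
  by rewrite !val_tperm; repeat case: ifP => ?; lia.
by case=> [|[/val_inj-> /val_inj->]]; [left|right].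
Qed.

(** Going up by the exchange and then down at (i, j), or down first and then up, leads to the same
    permutation; unless both moves use the same two positions, one route is available exactly when
    the other is. *)
Lemma bruhat_cover_tperm w i j p q : j = i.+1 :> nat ->
    ~ (p = i :> nat /\ q = j :> nat) -> ~ (p = j :> nat /\ q = i :> nat) ->
  bruhat_cover w p q && (w (tperm p q j) < w (tperm p q i))
    = (w j < w i) && bruhat_cover (tperm i j * w)%g (tperm i j p) (tperm i j q).
Proof.
move=> ij H1 H2; have sE := ltn_tperm_adjW ij.
apply/idP/idP.
  case/andP=> /bruhat_coverP[pq wpq btw] dsc; have Ci := btw i; have Cj := btw j.
  (* The cover condition enters when [p = i] or [q = j]: were [w i < w j], the value at the unmoved
     one of i and j would lie between [w p] and [w q]. *)
  have [desc_w iq jp] : [/\ w j < w i, q = i -> w j < w p & p = j -> w q < w i].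
  { have n1 := @val_neq w j p; have n2 := @val_neq w i q.
    move: dsc Ci Cj; case: (tpermP p q i) => [Ei|Ei|/ord_neq Ei' /ord_neq Ei];
      case: (tpermP p q j) => [Ej|Ej|/ord_neq Ej' /ord_neq Ej] dsc Ci Cj; subst => //.
    all: try by exfalso; lia.
    all: try by exfalso; apply: H1.
    all: try by exfalso; apply: H2.
    all: by split; try move/(congr1 (@nat_of_ord N)); lia. }
  apply/andP; split=> //; apply/bruhat_cover_mulP; split=> //.
    by rewrite ltn_tperm_adj.
  move=> c sc cs wpc; case: (sE _ _ sc) => [pc|[pj ->]]; last exact/ltnW/jp.
  case: (sE _ _ cs) => [cq|[cj qi]]; first exact: btw.
  by move: wpc; rewrite cj ltnNge (ltnW (iq qi)).
case/andP=> desc_w /bruhat_cover_mulP[]; rewrite ltn_tperm_adj // => pq wpq btw.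
apply/andP; split.
  apply/bruhat_coverP; split=> // c pc cq wpc.
  case: (ltn_tperm_adjV ij pc) => [sc|[pi cj]]; last first.
    by move: wpc; rewrite pi cj ltnNge (ltnW desc_w).
  by case: (ltn_tperm_adjV ij cq) => [cs|[-> ->]]; [apply: btw | apply: ltnW].
have := @val_neq w j p; have := @val_neq w i q.
have := @val_neq w j q; have := @val_neq w i p.
have := btw i; have := btw j; rewrite tpermL tpermR.
move=> Cj Ci n1 n2 n3 n4.
case: (tpermP p q i) => [Ei|Ei|/ord_neq Ei' /ord_neq Ei];
  case: (tpermP p q j) => [Ej|Ej|/ord_neq Ej' /ord_neq Ej]; subst => //.
all: move: Cj Ci; rewrite !val_tperm.
all: repeat (case: eqP => ?; try (exfalso; lia)); lia.
Qed.

Definition cover_sign w p q : int :=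
  ((bruhat_cover w p q)%:R - (bruhat_cover w q p)%:R)%R.

Definition extremal i : bool := (i == 0 :> nat) || (i.+1 == N).

Definition fixes_extremal w : Prop := forall i, extremal i -> w i = i.

Lemma bruhat_cover_adj w i j : j = i.+1 :> nat -> bruhat_cover w i j = (w i < w j).
Proof.
move=> ij; apply/bruhat_coverP/idP => [[]//|wij].
by split=> // [|c ic cj]; lia.
Qed.

Lemma bruhat_cover_gt w i j : j < i -> bruhat_cover w i j = false.
Proof. by move=> ltji; rewrite /bruhat_cover ltnNge (ltnW ltji). Qed.

Lemma cover_signC w p q : (cover_sign w q p = - cover_sign w p q)%R.
Proof. by rewrite /cover_sign opprB. Qed.

Lemma cover_sign_adj w i j : j = i.+1 :> nat -> cover_sign w i j = (w i < w j)%:R%R.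
Proof.
move=> ij; rewrite /cover_sign bruhat_cover_adj // bruhat_cover_gt ?subr0 //; lia.
Qed.

(** For the exceptional pair (i, j) the left side is 1 if [w i < w j] and 0 otherwise, the product
    on the right is -1 if [w j < w i] and 0 otherwise, and they differ by 1; the pair (j, i) is the
    negative of this. *)
Lemma cover_sign_tperm w i j p q : j = i.+1 :> nat ->
  (cover_sign w p q * (w (tperm p q j) < w (tperm p q i))%:R
   = (w j < w i)%:R * cover_sign (tperm i j * w)%g (tperm i j p) (tperm i j q)
     + (((p == i) && (q == j))%:R - ((p == j) && (q == i))%:R))%R.
Proof.
move=> ij; have nij : i != j by apply/eqP=> eij; move: ij; rewrite eij; lia.
have nwij : w i <> w j :> nat by apply: val_neq; lia.
have [/andP[/eqP-> /eqP->]|H1] := boolP ((p == i) && (q == j)).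
  rewrite !tpermL !tpermR (negPf nij) subr0 [cover_sign (_ * _)%g _ _]cover_signC.
  rewrite !cover_sign_adj //.
  by rewrite !permM tpermL tpermR; case: ltngtP nwij => // _ _; apply/eqP.
have [/andP[/eqP-> /eqP->]|H2] := boolP ((p == j) && (q == i)).
  rewrite !tpermL !tpermR [cover_sign w _ _]cover_signC !cover_sign_adj //.
  by rewrite !permM tpermL tpermR; case: ltngtP nwij => // _ _; apply/eqP.
rewrite subrr addr0 /cover_sign mulrBl mulrBr -!natrM !mulnb.
rewrite bruhat_cover_tperm //; first rewrite [in X in (_ - X)%R]tpermC bruhat_cover_tperm //.
- by case=> /val_inj eq /val_inj ep; rewrite ep eq !eqxx in H2.
- by case=> /val_inj eq /val_inj ep; rewrite ep eq !eqxx in H1.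
- by case=> /val_inj eq /val_inj ep; rewrite ep eq !eqxx in H1.
- by case=> /val_inj eq /val_inj ep; rewrite ep eq !eqxx in H2.
Qed.

(** A fixed first position holds the least value and a fixed last one the greatest, so neither takes
    part in a descent. *)
Lemma fixes_extremal_descent w i j : fixes_extremal w -> descent w (i, j) ->
  [/\ ~~ extremal i, ~~ extremal j & fixes_extremal (tperm i j * w)%g].
Proof.
move=> fw /andP[/= /eqP ij wji].
have ei : ~~ extremal i.
  apply/negP=> ei; move: wji (fw i ei) => /[swap] ->.
  by move: ei (ltn_ord j); rewrite /extremal => /orP[] /eqP; lia.
have ej : ~~ extremal j.
  apply/negP=> ej; move: wji (fw j ej) => /[swap] ->.
  by move: ej (ltn_ord (w i)); rewrite /extremal => /orP[] /eqP; lia.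
split=> // k ek; rewrite permM tpermD ?fw //.
  by apply: contraNneq ei => ->.
by apply: contraNneq ej => ->.
Qed.

(* The transition formula.  The value being exchanged is given by its position
   p; the fixed extremal points ensure that p always has two neighbours, so that
   the two exceptional terms of cover_sign_tperm cancel out. *)
Lemma cover_sum_eq0 n w p : fixes_extremal w -> ~~ extremal p ->
  (\sum_q cover_sign w p q * (num_walks n (tperm p q * w)%g)%:R = 0 :> int)%R.
Proof.
elim: n w p => [|n IH] w p fw np.
  apply: big1 => q _ /=; case: eqP => [e|]; last by rewrite mulr0.
  (* In a nonzero term w is this transposition, which puts the smaller value at the larger of the
     two positions, so neither cover exists. *)
  have -> : w = tperm p q by rewrite -[w]mul1g -(tperm2 p q) -mulgA e mulg1.
  rewrite /cover_sign /bruhat_cover tpermL tpermR.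
  by case: (ltngtP p q); rewrite subrr mul0r.
pose X (ij : 'I_N * 'I_N) q : int :=
  ((num_walks n (tperm ij.1 ij.2 * (tperm p q * w))%g)%:R)%R.
pose adj (ij : 'I_N * 'I_N) := ij.2 == ij.1.+1 :> nat.
(* By [cover_sign_tperm], the first sum takes the descent of w before the cover and vanishes by
   induction; the second collects the exceptional terms. *)
transitivity (\sum_(ij | adj ij) \sum_q
    (w ij.2 < w ij.1)%:R * (cover_sign (tperm ij.1 ij.2 * w)%g
        (tperm ij.1 ij.2 p) (tperm ij.1 ij.2 q) * X ij q)
  + \sum_(ij | adj ij) \sum_q
    (((p == ij.1) && (q == ij.2))%:R - ((p == ij.2) && (q == ij.1))%:R) * X ij q)%R.
  rewrite -big_split /=; under eq_bigr => q _ do rewrite natr_sum big_distrr big_mkcondr /=.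
  rewrite exchange_big; apply: eq_bigr => -[i j] /eqP/= ij; rewrite -big_split /=.
  apply: eq_bigr => q _; rewrite mulrA -mulrDl -cover_sign_tperm // !permM -/(X (i, j) q).
  by case: ifP; rewrite ?mulr1 ?mulr0 ?mul0r.
rewrite [X in (X + _)%R]big1 ?add0r.
  have inner ij : adj ij -> (\sum_q (((p == ij.1) && (q == ij.2))%:R
      - ((p == ij.2) && (q == ij.1))%:R) * X ij q
      = ((p == ij.1)%:R - (p == ij.2)%:R) * (num_walks n w)%:R :> int)%R.
    case: ij => i j _ /=; under eq_bigr => q _ do rewrite mulrBl.
    rewrite sumrB mulrBl; congr (_ - _)%R.
      rewrite (bigD1 j) //= big1 ?addr0 => [|q /negPf->]; last by rewrite andbF mul0r.
      rewrite eqxx andbT; case: eqP => [e|]; last by rewrite !mul0r.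
      by rewrite /X e /= mulgA tperm2 mul1g.
    rewrite (bigD1 i) //= big1 ?addr0 => [|q /negPf->]; last by rewrite andbF mul0r.
    rewrite eqxx andbT; case: eqP => [e|]; last by rewrite !mul0r.
    by rewrite /X e /= [tperm j i]tpermC mulgA tperm2 mul1g.
  (* Among the adjacent pairs, p is the left member only of (p, p + 1) and the right member only of
     (p - 1, p); these two contributions cancel. *)
  rewrite (eq_bigr _ inner) -big_distrl /= sumrB.
  move: np; rewrite /extremal negb_or => /andP[p_gt0 p_lt].
  have ltp : p.+1 < N by rewrite ltn_neqAle p_lt ltn_ord.
  have ltp' : p.-1 < N by apply: leq_ltn_trans (leq_pred p) (ltn_ord p).
  rewrite [X in (X - _)%R](bigD1 (p, Ordinal ltp)) /adj //= eqxx big1 => [|[i j]]; last first.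
    case/andP=> /eqP/= ji; case: (eqVneq p i) => // e; rewrite -{}e in ji * => /eqP[].
    by congr (_, _); apply: val_inj.
  rewrite [X in (_ - X)%R](bigD1 (Ordinal ltp', p)) /= ?eqxx ?prednK ?lt0n //.
  rewrite big1 => [|[i j]]; first by rewrite subrr mul0r.
  case/andP=> /eqP/= ji; case: (eqVneq p j) => // e; rewrite -{}e in ji * => /eqP[].
  by congr (_, _); apply: val_inj; rewrite /= ji.
case=> i j /eqP/= ij; rewrite -big_distrr /=.
have [wji|] := ltnP (w j) (w i); last by rewrite mul0r.
have [ei ej fs] : [/\ ~~ extremal i, ~~ extremal j & fixes_extremal (tperm i j * w)%g].
  by apply: fixes_extremal_descent => //; rewrite /descent ij eqxx.
(* The induction hypothesis is used at the image of p under [tperm i j]; conjugating [tperm p q] by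
   [tperm i j] matches the summands. *)
rewrite mul1r -[RHS](IH (tperm i j * w)%g (tperm i j p) fs); last by case: tpermP => // ->.
rewrite [RHS](reindex_inj (@perm_inj _ (tperm i j))) /=; apply: eq_bigr => q _.
rewrite /X -tpermJ conjgE tpermV !mulgA.
by rewrite -[(_ * _ * tperm i j * tperm i j)%g]mulgA tperm2 mulg1.
Qed.

(* The last position is exempted: it holds the largest value, as a padding. *)
Definition avoids213 w : Prop := forall a b c : 'I_N,
  a < b -> b < c -> w b < w a -> w a < w c -> c.+1 = N.

Lemma transition_padded n w i j p : fixes_extremal w -> avoids213 w ->
    descent w (i, j) -> p < j -> w j < w p ->
    (forall k : 'I_N, k < j -> w j < w k -> w p <= w k) ->
  num_walks n (tperm i j * w)%g = num_walks n (tperm p j * w)%g.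
Proof.
move=> fw av /[dup] dsc /andP[/eqP/= ij wji] pj wjp minp.
have [-> //|/eqP/ord_neq npi] := eqVneq p i.
have lt_pi : p < i by lia.
have wpi : w p < w i.
  have := minp i; have := @val_neq w _ _ npi; rewrite ij leqnn => ne /(_ isT wji); lia.
have [ei ej fs] := fixes_extremal_descent fw dsc.
have ep : ~~ extremal p.
  apply/negP=> ep; move: wjp (fw p ep) => /[swap] ->.
  by move: ep (ltn_ord i); rewrite /extremal => /orP[] /eqP; lia.
(* The word of w is .. z .. x y .., that of u is .. y .. z x ..; the only covers
   of u that move z exchange it with x, giving w with y and z exchanged, or with
   y, giving w with x and y exchanged. *)
pose u := (tperm i j * tperm p j * w)%g.
have [nip njp nji] : [/\ i != p, j != p & j != i].
  by split; apply/eqP => /(congr1 (@nat_of_ord N)); lia.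
have up : u p = w j by rewrite !permM (tpermD nip njp) tpermL.
have ui : u i = w p by rewrite !permM tpermL tpermR.
have uj : u j = w i by rewrite !permM tpermR tpermD // eq_sym.
have uE q : q != i -> q != j -> q != p -> u q = w q.
  by move=> qi qj qp; rewrite !permM !tpermD // eq_sym.
have fu : fixes_extremal u.
  move=> k ek; rewrite uE ?fw //.
  - by apply: contraNneq ei => <-.
  - by apply: contraNneq ej => <-.
  - by apply: contraNneq ep => <-.
have := cover_sum_eq0 n fu ei.
(* For q beyond j, positions p, j, q would form a 213 pattern unless q is last; but then it holds
   the greatest value, and [w i], now at j, lies in between. *)
have coverR q : bruhat_cover u i q = (q == j).
  apply/bruhat_coverP/eqP => [[iq]|->]; last first.
    by rewrite ui uj; split=> // [|c]; lia.
  have [//|/eqP/ord_neq nqj] := eqVneq q j.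
  rewrite ui => uq /(_ j); rewrite uj; have jq : j < q by lia.
  have Eq : u q = w q by apply: uE; apply/eqP => /(congr1 (@nat_of_ord N)); lia.
  move: uq; rewrite Eq => uq /(_ _ jq wpi); rewrite ij leqnn => /(_ isT) le_qi.
  have := av p j q pj jq wjp uq.
  have := @val_neq w q i.
  have := ltn_ord (w i).
  have := fw q; rewrite /extremal => Fq.
  move=> ? ? qN; move: Fq; rewrite qN eqxx orbT => /(_ isT)/(congr1 (@nat_of_ord N)).
  lia.
(* For q other than p, minimality of [w p] forces [w q < w j]. If q precedes p, the value [w j] at p
   lies in between; otherwise p, q, i form a 213 pattern. *)
have coverL q : bruhat_cover u q i = (q == p).
  apply/bruhat_coverP/eqP => [[qi]|->]; last first.
    rewrite ui up; split=> // c pc ci.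
    have -> : u c = w c by apply: uE; apply/eqP => /(congr1 (@nat_of_ord N)); lia.
    by apply: minp; lia.
  have [//|/[dup] nqp /eqP/ord_neq nqp'] := eqVneq q p.
  have -> : u q = w q by apply: uE => //; apply/eqP => /(congr1 (@nat_of_ord N)); lia.
  rewrite ui => wqp /(_ p); rewrite up => btw.
  have wqj : w q < w j.
    have := minp q; have := @val_neq w q j; lia.
  have pq : p < q by lia.
  have := av p q i pq qi wqp wpi; have := ltn_ord j; lia.
rewrite /cover_sign; under eq_bigr => q _ do rewrite coverR coverL mulrBl.
rewrite sumrB (bigD1 j) //= big1 => [|q /negPf->]; last by rewrite mul0r.
rewrite [X in (_ - X)%R](bigD1 p) //= [X in (_ - (_ + X))%R]big1 => [|q /negPf->]; last first.
  by rewrite mul0r.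
rewrite !eqxx !mul1r !addr0 => /eqP; rewrite subr_eq0 eqr_nat => /eqP.
have -> : (tperm i j * u)%g = (tperm p j * w)%g by rewrite /u -mulgA !mulgA tperm2 mul1g.
suff -> : (tperm i p * u)%g = (tperm i j * w)%g by [].
rewrite /u !mulgA; congr (_ * _)%g; apply/permP => k; rewrite !permM.
have [->|ki] := eqVneq k i; first by rewrite !tpermL (tpermD nip njp) tpermL.
have [->|kp] := eqVneq k p; first by rewrite tpermR tpermL tpermR tpermD // eq_sym.
have [->|kj] := eqVneq k j.
  by rewrite [tperm i p j]tpermD 1?eq_sym // !tpermR tpermD // eq_sym.
by rewrite !tpermD // eq_sym.
Qed.

End Walks.

(** * Walks from 213-avoiding permutations *)

Section Padding.

Lemma tperm_lift N (h : 'I_N.+1) (i j : 'I_N) :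
  tperm (lift h i) (lift h j) = lift_perm h h (tperm i j).
Proof.
apply/permP => k; case: (unliftP h k) => [l ->|->].
  by rewrite lift_perm_lift inj_tperm //; apply: lift_inj.
by rewrite lift_perm_id tpermD // eq_sym neq_lift.
Qed.

(** The added fixed point holds the least value in front or the greatest at the end, so it is in no
    descent, and all walks stay inside the original positions. *)
Lemma num_walks_lift N (h : 'I_N.+1) n (w : 'S_N) :
  (h == ord0) || (h == ord_max) ->
  num_walks n (lift_perm h h w) = num_walks n w.
Proof.
move=> hext; elim: n w => [|n IH] w /=.
  congr nat_of_bool; apply/eqP/eqP => [e|->]; last exact: lift_perm1.
  apply/permP => k; apply: (@lift_inj _ h).
  by rewrite -(lift_perm_lift h) e !perm1.
pose f (ij : 'I_N * 'I_N) := (lift h ij.1, lift h ij.2).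
pose g (ij : 'I_N.+1 * 'I_N.+1) : option ('I_N * 'I_N) :=
  if unlift h ij.1 is Some i then
    if unlift h ij.2 is Some j then Some (i, j) else None
  else None.
have dE ij : descent (lift_perm h h w) (f ij) = descent w ij.
  case: ij => i j; rewrite /descent /= !lift_perm_lift /=.
  have [ltj ltwj] := (ltn_ord j, ltn_ord (w j)).
  have [lti ltwi] := (ltn_ord i, ltn_ord (w i)).
  by case/orP: hext => /eqP->; rewrite /bump /=; lia.
rewrite (reindex_omap f g) => [|[i j]].
  apply: eq_big => [[i j]|[i j] _].
    by rewrite dE /g /= !liftK eqxx andbT.
  by rewrite /= tperm_lift lift_permM IH.
rewrite /descent /g /=; case: (unliftP h i) => [i' ->|->].
  case: (unliftP h j) => [j' -> //|->].
  case/andP=> /eqP hi; rewrite lift_perm_id lift_perm_lift.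
  case/orP: hext hi => /eqP->; rewrite ?lift_max ?lift0 //=.
  by move=> _; have := ltn_ord (w i'); lia.
case/andP=> /eqP hi; rewrite lift_perm_id.
by case/orP: hext hi => /eqP-> //=; have := ltn_ord j; lia.
Qed.

End Padding.

Section Codes.
Variable M : nat.
Implicit Types (w : 'S_M) (i j p : 'I_M).

Definition strictly_avoids213 w : Prop := forall a b c : 'I_M,
  a < b -> b < c -> w b < w a -> w c <= w a.

(** Adding a fixed point at each end reduces to [transition_padded]: the original positions become
    the non-extremal ones, and walks are counted alike. *)
Lemma transition n w i j p : strictly_avoids213 w ->
    descent w (i, j) -> p < j -> w j < w p ->
    (forall k : 'I_M, k < j -> w j < w k -> w p <= w k) ->
  num_walks n (tperm i j * w)%g = num_walks n (tperm p j * w)%g.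
Proof.
move=> av dsc pj wjp minp.
pose e (k : 'I_M) := lift ord0 (lift ord_max k) : 'I_M.+2.
pose pad (v : 'S_M) : 'S_M.+2 :=
  lift_perm ord0 ord0 (lift_perm ord_max ord_max v).
have padE v k : pad v (e k) = e (v k) by rewrite !lift_perm_lift.
have val_e k : e k = k.+1 :> nat by rewrite /e lift0 lift_max.
have num_pad v : num_walks n (pad v) = num_walks n v.
  by rewrite !num_walks_lift ?eqxx ?orbT.
have pad_tperm a b v : pad (tperm a b * v)%g = (tperm (e a) (e b) * pad v)%g.
  by rewrite /pad /e !tperm_lift !lift_permM.
have pad0 v : pad v ord0 = ord0 by rewrite lift_perm_id.
have pad_max v : pad v ord_max = ord_max.
  have -> : ord_max = lift ord0 ord_max :> 'I_M.+2 by apply: val_inj.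
  by rewrite lift_perm_lift lift_perm_id.
have eP (k : 'I_M.+2) : ~~ extremal k -> exists k', k = e k'.
  case: (unliftP ord0 k) => [l ->|-> //]; case: (unliftP ord_max l) => [k' ->|->].
    by exists k'.
  by rewrite /extremal lift0 eqxx orbT.
rewrite -[LHS]num_pad -[RHS]num_pad !pad_tperm; apply: transition_padded.
- move=> k /orP[/eqP k0|/eqP kM].
    by have -> : k = ord0 by apply: val_inj.
  by have -> : k = ord_max by apply: val_inj; apply: succn_inj.
- move=> a b c ab bc wba wac; apply/eqP; apply/negPn/negP => ncM.
  have /eP[c' Ec] : ~~ extremal c by rewrite /extremal negb_or ncM; lia.
  have /eP[b' Eb] : ~~ extremal b by rewrite /extremal negb_or; have := ltn_ord c; lia.
  have /eP[a' Ea] : ~~ extremal a.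
    rewrite /extremal negb_or; have := ltn_ord c.
    case: (eqVneq (val a) 0) => [a0|]; last by rewrite /= => a0; lia.
    have Ea : a = ord0 by apply: val_inj.
    by move: wba; rewrite Ea pad0.
  move: ab bc wba wac; rewrite Ea Eb Ec !padE !val_e !ltnS => ab bc wba.
  by rewrite ltnNge (av a' b' c').
- suff: (e j == (e i).+1 :> nat) && (pad w (e j) < pad w (e i)) by [].
  by rewrite !padE !val_e.
- by rewrite !val_e.
- by rewrite !padE !val_e.
- move=> k; rewrite !padE val_e => kj.
  case: (eqVneq (val k) 0) => [k0|k0].
    have Ek : k = ord0 by apply: val_inj.
    by rewrite Ek pad0.
  have /eP[k' Ek] : ~~ extremal k.
    rewrite /extremal negb_or k0; have := ltn_ord j; lia.
  by move: kj; rewrite Ek !padE !val_e !ltnS; apply: minp.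
Qed.

Definition monotone_code w : Prop :=
  forall i j, j = i.+1 :> nat -> inv_code w i <= inv_code w j.

(** Given a pattern a, b, c, let k be the first position after b whose value exceeds [w a]. Its
    predecessor has a value below [w a], so it has every inversion of k and also the one with a: the
    code drops at k. *)
Lemma monotone_code_avoids213 w : monotone_code w -> strictly_avoids213 w.
Proof.
move=> mono a b c ab bc wba; rewrite leqNgt; apply/negP => wac.
have exc : exists l : nat, [exists k : 'I_M, [&& k == l :> nat, b < k & w a < w k]].
  by exists c; apply/existsP; exists c; rewrite eqxx bc.
case: (ex_minnP exc) => l /existsP[k /and3P[/eqP kl bk wak]] minl.
have ltk' : k.-1 < M by apply: leq_ltn_trans (leq_pred k) (ltn_ord k).
pose k' := Ordinal ltk'.
have kk' : k = k'.+1 :> nat by rewrite /= prednK //; lia.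
have wk'a : w k' <= w a.
  rewrite leqNgt; apply/negP => wk'; have [bk'|] := ltnP b k'; last first.
    move=> le; have Ek : k' = b by apply: val_inj => /=; move: le bk => /=; lia.
    by move: wk'; rewrite Ek; lia.
  suff /minl : [exists x : 'I_M, [&& x == k' :> nat, b < x & w a < w x]].
    by rewrite -kl kk' ltnn.
  by apply/existsP; exists k'; rewrite eqxx bk'.
have {}wk'a : w k' < w a.
  have := @val_neq _ w k' a; rewrite /=; lia.
have /proper_card : [set j : 'I_M | (j < k) && (w k < w j)]
      \proper [set j : 'I_M | (j < k') && (w k' < w j)].
  apply/properP; split.
    apply/subsetP => j; rewrite !inE kk' ltnS leq_eqVlt.
    move=> /andP[/orP[/eqP/val_inj->|]]; first lia.
    by move=> -> wkj /=; lia.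
  exists a; rewrite !inE; first by rewrite wk'a andbT /=; lia.
  by rewrite negb_and -!leqNgt (ltnW wak) orbT.
by rewrite -/(inv_code w k) -/(inv_code w k') ltnNge mono.
Qed.

Lemma inv_code_descent w i j : descent w (i, j) -> inv_code w i < inv_code w j.
Proof.
case/andP=> /= /eqP ij wji; apply: proper_card; apply/properP; split.
  by apply/subsetP => k; rewrite !inE; lia.
by exists i; rewrite !inE ?ltnn // ij leqnn.
Qed.

(** A value between [w i] and [w j] standing before i would form a 213 pattern with them. *)
Lemma inv_code_ascent w i j : strictly_avoids213 w -> j = i.+1 :> nat ->
  ~~ descent w (i, j) -> inv_code w i = inv_code w j.
Proof.
move=> av ij; rewrite /descent /= ij eqxx /= -leqNgt => wij.
have {}wij : w i < w j by have := @val_neq _ w i j; lia.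
apply: eq_card => k; rewrite !inE; apply/andP/andP => -[]; last first.
  rewrite ij ltnS leq_eqVlt => /orP[/eqP/val_inj->|]; [lia|].
  by move=> ->; lia.
move=> ki wik; split; first by lia.
have := av k i j ki; have := @val_neq _ w k j; lia.
Qed.

Lemma avoids213_monotone_code w : strictly_avoids213 w -> monotone_code w.
Proof.
move=> av i j ij; case: (boolP (descent w (i, j))) => [/inv_code_descent/ltnW //|].
by move/(inv_code_ascent av ij)->.
Qed.

(** No position before j holds a value strictly between [w j] and [w p], so the exchange affects
    only the inversion of p with j. *)
Lemma inv_code_transition w i j p : strictly_avoids213 w -> 
    descent w (i, j) -> p < j -> w j < w p ->
    (forall k : 'I_M, k < j -> w j < w k -> w p <= w k) ->
  inv_code (tperm p j * w)%g =1 decr (inv_code w) j.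
Proof.
move=> av /andP[/= /eqP ij wji] pj wjp minp k; rewrite /decr.
have np : p <> j :> nat by lia.
have w'E l : (tperm p j * w)%g l = w (tperm p j l) by rewrite permM.
have w'D l : l <> p -> l <> j -> (tperm p j * w)%g l = w l.
  by move=> lp lj; rewrite w'E tpermD //; apply/eqP => e; [apply: lp | apply: lj].
have w'p : (tperm p j * w)%g p = w j by rewrite w'E tpermL.
have w'j : (tperm p j * w)%g j = w p by rewrite w'E tpermR.
case: (eqVneq k j) => [->|/eqP kj].
  rewrite /inv_code w'j.
  set B := [set l : 'I_M | (l < j) && (w p < _)].
  have pB : p \notin B by rewrite !inE w'p pj ltnNge (ltnW wjp).
  suff -> : [set l : 'I_M | (l < j) && (w j < w l)] = p |: B.
    by rewrite cardsU1 pB addKn.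
  apply/setP => l; rewrite !inE.
  case: (eqVneq l p) => [->|/eqP lp]; first by rewrite pj wjp.
  case: (ltnP l j) => //= lj.
  rewrite w'D //; last by move=> e; rewrite e ltnn in lj.
  apply/idP/idP => [wjl|]; last exact: ltn_trans.
  by have := minp l lj wjl; have := @val_neq _ w l p (ord_neq lp); lia.
rewrite subn0 /inv_code; have [jk|kj'|] := ltngtP j k; last by move/val_inj => e; case: kj.
  have -> : (tperm p j * w)%g k = w k by apply: w'D => // e; rewrite e in jk; lia.
  (* Beyond j, the values to the left of k are merely permuted. *)
  rewrite -[RHS](card_preimset _ (@perm_inj _ (tperm p j))); apply: eq_card => l.
  rewrite !inE w'E; congr (_ && _); rewrite val_tperm.
  by repeat case: eqP => ?; lia.
apply: eq_card => l; rewrite !inE; case: (ltnP l k) => //= lk.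
have lj : l <> j by move=> e; rewrite e in lk; lia.
case: (eqVneq k p) => [Ek|/eqP kp].
  rewrite Ek w'p w'D //; last by move=> e; rewrite e Ek ltnn in lk.
  have lp : l <> p :> nat by rewrite -Ek; lia.
  have := minp l (ltn_trans lk kj'); have := @val_neq _ w l p lp; lia.
rewrite (w'D k) //; case: (eqVneq l p) => [El|/eqP lp]; last by rewrite w'D.
rewrite El w'p; have := minp k kj'; have := @val_neq _ w k p (ord_neq kp).
have := @val_neq _ w k j (ord_neq kj); lia.
Qed.

Lemma card_ord_lt (v : 'I_M) : #|[set x : 'I_M | x < v]| = v.
Proof.
rewrite -sum1_card (eq_bigl (fun x : 'I_M => x < v)) => [|x]; last by rewrite inE.
by rewrite -(big_ord_widen _ (fun=> 1)) ?sum1_card ?card_ord // ltnW.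
Qed.

Lemma sum_inv_code_eq0 w : (\sum_i inv_code w i == 0) = (w == 1%g).
Proof.
apply/eqP/eqP => [/eqP|->]; last first.
  apply: big1 => i _; apply: eq_card0 => j; rewrite !inE !perm1.
  by apply/negP => /andP[]; lia.
rewrite sum_nat_eq0 => /forallP c0.
have mono (i j : 'I_M) : i < j -> w i < w j.
  move=> ij; rewrite ltnNge; apply/negP => wji.
  have {}wji : w j < w i by have := @val_neq _ w i j; lia.
  have /(implyP (c0 j)) : true by [].
  by move=> /eqP/card0_eq/(_ i); rewrite !inE ij wji.
apply/permP => i; rewrite perm1; apply: val_inj => /=.
rewrite -[LHS]card_ord_lt -[RHS]card_ord_lt -(card_preimset _ (@perm_inj _ w)).
apply: eq_card => j; rewrite !inE; apply/idP/idP => [|/mono //].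
case: (ltngtP j i) => // [/mono|/val_inj->]; lia.
Qed.

Lemma exists_transition w i j : descent w (i, j) ->
  exists p : 'I_M, [/\ p < j, w j < w p &
    forall k : 'I_M, k < j -> w j < w k -> w p <= w k].
Proof.
case/andP=> /= /eqP ij wji.
have Pi : (i < j) && (w j < w i) by rewrite ij leqnn.
case: (@arg_minnP _ i (fun k : 'I_M => (k < j) && (w j < w k)) (fun k => w k) Pi).
move=> p /andP[pj wjp] minp; exists p; split=> // k kj wjk.
by apply: minp; rewrite kj.
Qed.

(** By [transition], each descent may be traded for lowering the code at its right end. Descents are
    exactly the strict rises of the code, so the recursion is that of [code_count_rec]; a walk to
    the identity has as many steps as w has inversions. *)
Lemma num_walks_code n w : monotone_code w ->
  ((num_walks n w)%:R
    = if n == \sum_i inv_code w i then code_count (inv_code w) else 0 :> rat)%R.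
Proof.
elim: n w => [|n IH] w mono.
  rewrite /= [0 == _]eq_sym sum_inv_code_eq0; case: eqP => // ->; rewrite code_count0 //.
  by apply/eqP; rewrite sum_inv_code_eq0.
have av := monotone_code_avoids213 mono.
pose c := inv_code w; pose prd (j : 'I_M) := Ordinal (leq_ltn_trans (leq_pred j) (ltn_ord j)).
have prdE i j : j = i.+1 :> nat -> prd j = i by move=> ij; apply: val_inj; rewrite /= ij.
pose G j : rat := (if n == \sum_i decr c j i then code_count (decr c j) else 0)%R.
have step (ij : 'I_M * 'I_M) : descent w ij ->
    ((num_walks n (tperm ij.1 ij.2 * w)%g)%:R = G ij.2 :> rat)%R.
  case: ij => i j /= dsc; have [p [pj wjp minp]] := exists_transition dsc.
  have cE := inv_code_transition av dsc pj wjp minp.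
  rewrite (transition n av dsc pj wjp minp) IH.
    by rewrite (eq_code_count cE) (eq_bigr _ (fun k _ => cE k)).
  (* The lowered code is still monotone, because the code rises strictly at a descent. *)
  move=> k l kl; rewrite !cE /decr.
  have := mono k l kl; have := inv_code_descent dsc.
  case: (eqVneq l j) => [El|_]; last lia.
  have -> : k = i by apply: val_inj; case/andP: dsc => /eqP; rewrite /= -El; lia.
  have -> : (i == j) = false by apply/eqP => e; case/andP: dsc => /eqP /=; rewrite e; lia.
  by rewrite El; lia.
rewrite /= natr_sum (eq_bigr _ step).
(* A descent is determined by its right end. For j = 0 the position [prd j] is 0 as well, and (0, 0)
   is not a descent. *)
have -> : (\sum_(ij | descent w ij) G ij.2 = \sum_(j | descent w (prd j, j)) G j)%R.
  rewrite (reindex_onto (fun j => (prd j, j)) snd) => [|[i j] /andP[/= /eqP ij _]].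
    by apply: eq_bigl => j; rewrite eqxx andbT.
  by rewrite (prdE i).
have Sgt0 j : descent w (prd j, j) -> 0 < c j.
  by move=> /inv_code_descent; apply: leq_ltn_trans.
have sumD j : descent w (prd j, j) -> \sum_i decr c j i = (\sum_i c i).-1.
  by move=> /Sgt0; apply: sum_decr.
case: eqP => [En|nEn]; last first.
  apply: big1 => j Sj; rewrite /G sumD //; case: eqP => // En; case: nEn.
  by rewrite En prednK // (bigD1 j) //= ltn_addr // Sgt0.
rewrite (@code_count_rec _ c (fun j => descent w (prd j, j))) //.
- by apply: eq_bigr => j Sj; rewrite /G sumD // -En eqxx.
- by rewrite -En.
- move=> j nSj; have [j0|j_gt0] := posnP j; [left|right].
    rewrite j0 addn0; apply: eq_card0 => k; by rewrite !inE j0.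
  exists (prd j); first by rewrite /= prednK.
  by apply: inv_code_ascent => //; rewrite /= prednK.
Qed.

End Codes.

(** * Maximal chains of a finite poset *)

Section Chains.
Variables (T : finType) (le : rel T) (rk : T -> nat) (bot : T).
Hypotheses (le_refl : reflexive le) (le_anti : antisymmetric le)
  (le_trans : transitive le) (rk_strict : forall x y, strict le x y -> rk x < rk y)
  (bot_min : forall x, le bot x).

Implicit Types (x y : T) (C : {set T}).

(** Replacing the maximum of the poset by an arbitrary end point x makes a recursion on x possible;
    covers are still those of the whole poset. *)
Definition saturated_chain_to (x : T) (C : {set T}) : bool :=
  [&& [forall a in C, forall b in C, le a b || le b a],
      bot \in C, x \in C, [forall a in C, le a x]
    & [forall a in C, forall b in C,
        strict le a b && ~~ [exists z in C, strict le a z && strict le z b]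
          ==> covered_by le a b]].

Lemma saturated_chain_toP x C :
  reflect [/\ {in C &, forall a b, le a b || le b a},
              bot \in C, x \in C, {in C, forall a, le a x} &
              {in C &, forall a b, strict le a b ->
                 (forall z, z \in C -> ~~ (strict le a z && strict le z b)) ->
                 covered_by le a b}]
          (saturated_chain_to x C).
Proof.
apply: (iffP and5P) => -[tot botC xC topx sat]; split=> //.
- by move=> a b aC bC; have /forall_inP/(_ a aC)/forall_inP/(_ b bC) := tot.
- by apply/forall_inP.
- move=> a b aC bC ab noz.
  have /forall_inP/(_ a aC)/forall_inP/(_ b bC)/implyP := sat; apply.
  rewrite ab; apply/negP => /existsP[z /andP[zC]]; exact/negP/noz.
- by apply/forall_inP => a aC; apply/forall_inP => b bC; apply: tot.
- by apply/forall_inP.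
- apply/forall_inP => a aC; apply/forall_inP => b bC; apply/implyP => /andP[ab noz].
  apply: sat => // z zC; apply: contra noz => azb.
  by apply/existsP; exists z; rewrite zC.
Qed.

Lemma strict_trans x y z : le x y -> strict le y z -> strict le x z.
Proof.
move=> xy /andP[nyz yz]; rewrite /strict (le_trans xy yz) andbT.
by apply: contraNneq nyz => exz; apply/eqP/le_anti; rewrite yz -exz.
Qed.

Lemma saturated_chain_to_uniq x y C :
  saturated_chain_to x C -> saturated_chain_to y C -> x = y.
Proof.
move=> /saturated_chain_toP[_ _ xC topx _] /saturated_chain_toP[_ _ yC topy _].
by apply: le_anti; rewrite topx // topy.
Qed.

Lemma saturated_chain_to_bot C : saturated_chain_to bot C = (C == [set bot]).
Proof.
apply/saturated_chain_toP/eqP => [[_ botC _ topb _]|->].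
  apply/setP => x; rewrite inE; apply/idP/eqP => [xC|-> //].
  by apply: le_anti; rewrite topb // bot_min.
split; rewrite ?inE // => a; first by move=> b; rewrite !inE => /eqP-> /eqP->; rewrite le_refl.
  by rewrite inE => /eqP->.
by move=> b; rewrite !inE => /eqP-> /eqP->; rewrite /strict eqxx.
Qed.

(** An element of largest rank in the rest of the chain is its maximum, by totality, and saturation
    makes x cover it. *)
Lemma saturated_chain_to_behead x C : x != bot -> saturated_chain_to x C ->
  exists2 y, covered_by le y x & saturated_chain_to y (C :\ x).
Proof.
move=> xbot /saturated_chain_toP[tot botC xC topx sat].
have botD : bot \in C :\ x by rewrite !inE eq_sym xbot.
case: (@arg_maxnP _ bot (mem (C :\ x)) rk botD) => y; rewrite /= => yD maxy.
have [yx yC] : y != x /\ y \in C by move: yD; rewrite !inE => /andP[].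
have topy z : z \in C :\ x -> le z y.
  move=> zD; have zC : z \in C by move: zD; rewrite !inE => /andP[].
  have /orP[//|yz] := tot z y zC yC.
  have [->//|nyz] := eqVneq y z.
  have /rk_strict : strict le y z by rewrite /strict nyz.
  by rewrite ltnNge; have /= -> := maxy z zD.
have cov_yx : covered_by le y x.
  apply: sat => // [|z zC]; first by rewrite /strict yx topx.
  apply/negP => /andP[yz /andP[zx _]].
  have zD : z \in C :\ x by rewrite !inE zx.
  have := strict_trans (topy z zD) yz; by rewrite /strict eqxx.
exists y => //; apply/saturated_chain_toP; split=> //.
  by move=> a b; rewrite !inE => /andP[_ aC] /andP[_ bC]; apply: tot.
move=> a b; rewrite !inE => /andP[_ aC] /andP[bx bC] ab noz; apply: sat => // z zC.
have [-> {z zC}|zx] := eqVneq z x; last by apply: noz; rewrite !inE zx.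
apply/negP => /andP[_ /(strict_trans (topx b bC))]; by rewrite /strict eqxx.
Qed.

Lemma saturated_chain_to_cons x y C : x \in C -> covered_by le y x ->
  saturated_chain_to y (C :\ x) -> saturated_chain_to x C.
Proof.
move=> xC cyx /saturated_chain_toP[tot botD yD topy sat].
have [syx _] := andP cyx; have [yx leyx] := andP syx.
have CE z : z \in C -> z = x \/ z \in C :\ x.
  by move=> zC; have [->|zx] := eqVneq z x; [left|right; rewrite !inE zx].
have topx z : z \in C -> le z x.
  by case/CE=> [-> //|/topy zy]; apply: le_trans leyx.
apply/saturated_chain_toP; split=> //.
- move=> a b aC bC; case: (CE a aC) => [->|aD]; first by rewrite topx ?orbT.
  case: (CE b bC) => [->|bD]; first by rewrite topx.
  exact: tot.
- by move: botD; rewrite !inE => /andP[].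
move=> a b aC bC ab noz.
case: (CE a aC) => [Ea|aD].
  by have := strict_trans (topx b bC); rewrite -Ea => /(_ _ ab); rewrite /strict eqxx.
case: (CE b bC) => [Eb|bD]; last first.
  by apply: sat => // z; rewrite !inE => /andP[_]; apply: noz.
have yC : y \in C by move: yD; rewrite !inE => /andP[].
have [->|ay] := eqVneq a y; first by rewrite Eb.
by have := noz y yC; rewrite Eb syx /strict ay topy.
Qed.

Definition num_saturated (x : T) : nat := #|[set C | saturated_chain_to x C]|.

Lemma num_saturated_bot : num_saturated bot = 1.
Proof.
rewrite /num_saturated -(cards1 [set bot]); apply: eq_card => C.
by rewrite !inE saturated_chain_to_bot.
Qed.

(** Double counting of pairs (C, y): deleting x from a chain ending at x leaves a chain ending at
    exactly one y, and any chain ending at some y covered by x extends by x. *)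
Lemma num_saturated_rec x : x != bot ->
  num_saturated x = \sum_(y | covered_by le y x) num_saturated y.
Proof.
move=> xbot; pose Q y C := (x \in C) && saturated_chain_to y (C :\ x).
have -> : num_saturated x = \sum_C \sum_(y | covered_by le y x) (Q y C : nat).
  rewrite /num_saturated -sum1_card big_mkcond /=; apply: eq_bigr => C _; rewrite inE.
  case: ifPn => [satC|nsatC]; last first.
    rewrite big1 // => y cyx; apply/eqP; rewrite eqb0; apply: contra nsatC.
    by case/andP=> xC; apply: saturated_chain_to_cons.
  have [y cyx satD] := saturated_chain_to_behead xbot satC.
  have xC : x \in C by case/saturated_chain_toP: satC.
  rewrite (bigD1 y) //= /Q xC satD big1 // => z /andP[_ zy].
  apply/eqP; rewrite eqb0; apply: contra zy => satz.
  by apply/eqP; apply: saturated_chain_to_uniq satz satD.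
rewrite exchange_big; apply: eq_bigr => y cyx.
have satx D : saturated_chain_to y D -> x \notin D.
  case/saturated_chain_toP=> _ _ _ topy _; apply/negP => /topy.
  case/andP: cyx => /andP[nyx yx] _ xy.
  by case/eqP: nyx; apply: le_anti; rewrite yx.
transitivity (\sum_(C | Q y C) 1); first by rewrite [RHS]big_mkcond.
rewrite /num_saturated -sum1_card.
rewrite (reindex_onto (fun D => x |: D) (fun C => C :\ x)) => [|C /andP[xC _]]; last first.
  by rewrite setD1K.
apply: eq_bigl => D; rewrite inE /Q !inE eqxx /=.
apply/andP/idP => [[satD /eqP <-] //|satD].
by rewrite setU1K ?satx.
Qed.

Lemma maximal_chain_saturated top C : (forall x, le x top) ->
  maximal_chain le C = saturated_chain_to top C.
Proof.
move=> le_top; rewrite /maximal_chain /saturated_chain_to; congr (_ && _).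
have -> : [exists x in C, is_minimum le x] = (bot \in C).
  apply/existsP/idP => [[x /andP[xC /forallP minx]]|botC].
    by have -> : bot = x by apply: le_anti; rewrite bot_min minx.
  by exists bot; rewrite botC; apply/forallP.
have -> : [exists x in C, is_maximum le x] = (top \in C).
  apply/existsP/idP => [[x /andP[xC /forallP maxx]]|topC].
    by have -> : top = x by apply: le_anti; rewrite le_top maxx.
  by exists top; rewrite topC; apply/forallP.
have -> : [forall x in C, le x top] by apply/forall_inP => x _.
by [].
Qed.

End Chains.

(** * Words and permutations *)

Section Inversions.
Variable M : nat.
Implicit Types (w : 'S_M) (i j p : 'I_M).

(** The new code is the old one with its j-th entry lowered, for the lost inversion of i with j, and
    then its entries at i and j exchanged. *)
Lemma sum_inv_code_descent w i j : descent w (i, j) ->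
  \sum_k inv_code (tperm i j * w)%g k = (\sum_k inv_code w k).-1.
Proof.
move=> dsc; rewrite -(sum_decr (leq_ltn_trans (leq0n _) (inv_code_descent dsc))).
rewrite [RHS](reindex_inj (@perm_inj _ (tperm i j))); apply: eq_bigr => k _.
have /andP[/= /eqP ij wji] := dsc.
have nij : i <> j :> nat by lia.
have nij' : i != j by apply/eqP => e; apply: nij; rewrite e.
have low (l : 'I_M) : l < i -> tperm i j l = l.
  by move=> li; rewrite tpermD //; apply/eqP => e; rewrite e in ij li; lia.
rewrite /decr /inv_code permM; case: (tpermP i j k) => [->|->|/ord_neq ki /ord_neq kj].
- rewrite eqxx.
  set B := [set l : 'I_M | (l < i) && _].
  have iB : i \notin B by rewrite !inE ltnn.
  suff -> : [set l : 'I_M | (l < j) && (w j < w l)] = i |: B by rewrite cardsU1 iB addKn.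
  apply/setP => l; rewrite !inE permM.
  have [->|/eqP/ord_neq li] := eqVneq l i; first by rewrite ij leqnn wji.
  have [lti|] := ltnP l i; first by rewrite low //= ij ltnS (ltnW lti).
  by move=> il; have -> : (l < j) = false by lia.
- rewrite (negPf nij') subn0; apply: eq_card => l; rewrite !inE permM.
  have [lti|] := ltnP l i; first by rewrite low // ij ltnS (ltnW lti).
  move=> il; have [lj|//] := ltnP l j.
  have -> : l = i by apply: val_inj => /=; lia.
  by rewrite tpermL ltnNge (ltnW wji).
have -> : (k == j) = false by apply/eqP => e; apply: kj; rewrite e.
rewrite subn0 -[RHS](card_preimset _ (@perm_inj _ (tperm i j))).
apply: eq_card => l; rewrite !inE permM; congr (_ && _).
by rewrite val_tperm; repeat case: eqP => ?; lia.
Qed.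

(** Without adjacent descents w is increasing, hence has no inversion. *)
Lemma exists_descent w : w != 1%g -> exists ij, descent w ij.
Proof.
move=> w1; have [[i j] dsc|nodesc] := pickP (descent w); first by exists (i, j).
case/negP: w1; rewrite -sum_inv_code_eq0.
have adj (i j : 'I_M) : j = i.+1 :> nat -> w i < w j.
  move=> ij; have := nodesc (i, j); rewrite /descent /= ij eqxx /=.
  by have := @val_neq _ w i j; lia.
have mono k (i j : 'I_M) : j = i + k.+1 :> nat -> w i < w j.
  elim: k j => [|k IH] j ij; first by apply: adj; rewrite ij addn1.
  have ltj : j.-1 < M by apply: leq_ltn_trans (leq_pred j) (ltn_ord j).
  apply: ltn_trans (IH (Ordinal ltj) _) (adj _ _ _) => /=; lia.
apply/eqP; apply: big1 => j _; apply: eq_card0 => i; rewrite !inE.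
apply/negP => /andP[ij]; rewrite ltnNge => /negP; apply; apply: ltnW.
by apply: (mono (j - i).-1); lia.
Qed.

Lemma tperm_adj_inj i j i' j' : j = i.+1 :> nat -> j' = i'.+1 :> nat ->
  tperm i j = tperm i' j' -> (i, j) = (i', j').
Proof.
move=> ij ij' e; have := congr1 (fun s : 'S_M => nat_of_ord (s i)) e.
rewrite tpermL val_tperm => Ej.
have Ei : i = i' by apply: val_inj => /=; move: Ej; repeat case: eqP => ?; lia.
by congr (_, _) => //; apply: val_inj; rewrite /= ij ij' Ei.
Qed.

End Inversions.

Section Standardization.
Variables (n M : nat).
Implicit Types (t : M.-tuple 'I_n) (p q : 'I_M).

Definition lex_lt t p q : bool :=
  (tnth t p < tnth t q) || ((tnth t p == tnth t q) && (p < q)).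

Lemma lex_lt_trans t : transitive (lex_lt t).
Proof.
move=> q p r; rewrite /lex_lt -!val_eqE /=; lia.
Qed.

Lemma lex_lt_irr t p : lex_lt t p p = false.
Proof. by rewrite /lex_lt !ltnn andbF. Qed.

Lemma lex_lt_total t p q : p != q -> lex_lt t p q || lex_lt t q p.
Proof. rewrite /lex_lt -!val_eqE /=; lia. Qed.

Lemma lex_rank_lt t p : #|[set q | lex_lt t q p]| < M.
Proof.
rewrite -[X in _ < X]card_ord; apply: proper_card; apply/properP; split=> //.
  exact/subsetP.
by exists p; rewrite // inE lex_lt_irr.
Qed.

Definition lex_rank t p : 'I_M := Ordinal (lex_rank_lt t p).

Lemma ltn_lex_rank t p q : lex_lt t p q -> lex_rank t p < lex_rank t q.
Proof.
move=> pq; apply: proper_card; apply/properP; split.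
  by apply/subsetP => r; rewrite !inE => /lex_lt_trans; apply.
by exists p; rewrite !inE ?lex_lt_irr.
Qed.

Lemma lex_rank_inj t : injective (lex_rank t).
Proof.
move=> p q e; apply/eqP; apply/negPn/negP => /(lex_lt_total t).
by case/orP => /ltn_lex_rank; rewrite e ltnn.
Qed.

(* The inverse of the map sending each copy of a letter to its position. *)
Definition std t : 'S_M := perm (@lex_rank_inj t).

Lemma ltn_std t p q : (std t p < std t q) = lex_lt t p q.
Proof.
rewrite !permE; apply/idP/idP => [|/ltn_lex_rank//].
have [->|/(lex_lt_total t)/orP[//|/ltn_lex_rank]] := eqVneq p q; first by rewrite ltnn.
by move=> h1 h2; have := ltn_trans h1 h2; rewrite ltnn.
Qed.

(** A permutation is recovered from the relative order of its values, as [w p] counts the smaller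
    ones. *)
Lemma std_uniq t (w : 'S_M) : (forall p q, (w p < w q) = lex_lt t p q) -> w = std t.
Proof.
move=> wE; apply/permP => p; apply: val_inj => /=.
rewrite -[LHS]card_ord_lt -[RHS]card_ord_lt.
rewrite -(card_preimset _ (@perm_inj _ w)) -[RHS](card_preimset _ (@perm_inj _ (std t))).
by apply: eq_card => q; rewrite !inE wE ltn_std.
Qed.

Definition swap_word t p q : M.-tuple 'I_n := [tuple tnth t (tperm p q k) | k < M].

Lemma swap_wordK t p q : swap_word (swap_word t p q) p q = t.
Proof. by apply: eq_from_tnth => k; rewrite !tnth_mktuple tpermK. Qed.

Lemma descent_std t p q :
  descent (std t) (p, q) = (q == p.+1 :> nat) && (tnth t q < tnth t p).
Proof.
rewrite /descent /= ltn_std /lex_lt; case: eqP => //= pq.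
by rewrite [q < p]ltnNge pq leqnSn /= andbF orbF.
Qed.

(** The two letters exchanged are distinct, so copies of the same letter keep their relative
    order. *)
Lemma std_swap_word t p q : descent (std t) (p, q) ->
  std (swap_word t p q) = (tperm p q * std t)%g.
Proof.
rewrite descent_std => /andP[/eqP pq tqp]; symmetry; apply: std_uniq => a b.
rewrite !permM ltn_std /lex_lt !tnth_mktuple; congr (_ || _).
case: eqP => //= tab; rewrite ltn_tperm_adj // => -[/val_inj Ea /val_inj Eb].
  by move: tab tqp; rewrite Ea Eb tpermL tpermR => ->; rewrite ltnn.
by move: tab tqp; rewrite Ea Eb tpermL tpermR => ->; rewrite ltnn.
Qed.

Lemma perm_swap_word t p q : perm_eq (swap_word t p q) t.
Proof. by apply/tuple_permP; exists (tperm p q). Qed.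

End Standardization.

(** * The poset BL(m) *)

Section BLPoset.
Variables (n : nat) (m : 'I_n -> nat) (m_gt0 : forall i, 0 < m i).
Notation M := (mult_size m).
Implicit Types (t : word m) (p q : 'I_M) (x y : BL m).

Lemma is_BLP t : reflect
  ((forall i, count_mem i t = m i) /\
   (forall i j : 'I_n, j = i.+1 :> nat -> index i t < index j t)) (is_BL t).
Proof.
apply: (iffP andP) => -[cnt idx]; split.
- by move=> i; apply/eqP/(forallP cnt).
- by move=> i j ij; have /forallP/(_ j)/implyP := forallP idx i; apply; apply/eqP.
- by apply/forallP => i; apply/eqP.
- by do 2![apply/forallP => ?]; apply/implyP => /eqP; apply: idx.
Qed.

Lemma mem_BL t i : is_BL t -> i \in (t : seq _).
Proof. by case/is_BLP=> cnt _; rewrite -has_pred1 has_count cnt. Qed.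

Lemma index_tnth t p : index (tnth t p) t <= p.
Proof.
rewrite leqNgt; apply/negP => /(before_find (tnth t p)).
by rewrite -tnth_nth /= eqxx.
Qed.

Lemma BL_letterP t i : i \in (t : seq _) ->
  exists2 r : 'I_M, r = index i t :> nat & tnth t r = i.
Proof.
move=> it; have ltr : index i t < M by rewrite -[X in _ < X](size_tuple t) index_mem.
by exists (Ordinal ltr) => //; rewrite (tnth_nth i) /= nth_index.
Qed.

(* A swap can only break the order of first occurrences by exchanging the first
   occurrences of two consecutive letters. *)
Lemma is_BL_swap t p q : is_BL t -> q = p.+1 :> nat ->
    ~ (tnth t q = (tnth t p).+1 :> nat /\ index (tnth t p) t = p) ->
  is_BL (swap_word t p q).
Proof.
move=> BLt pq notfirst; have /is_BLP[cnt idx] := BLt.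
apply/is_BLP; split=> [i|i j ij].
  by have /seq.permP-> := perm_swap_word t p q.
have memt k : k \in (swap_word t p q : seq _).
  by rewrite (perm_mem (perm_swap_word t p q)) mem_BL.
have [P EP tP] := BL_letterP (mem_BL i BLt).
have [R ER tR] := BL_letterP (memt j); rewrite -ER.
rewrite tnth_mktuple in tR.
have leP : index i (swap_word t p q) <= tperm p q P.
  by have := index_tnth (swap_word t p q) (tperm p q P); rewrite tnth_mktuple tpermK tP.
apply: leq_ltn_trans leP _.
have ltPR : P < tperm p q R.
  by rewrite EP; apply: leq_trans (idx i j ij) _; rewrite -tR index_tnth.
case: (ltn_tperm_adjV pq ltPR) => [|[Ep Eq]]; first by rewrite tpermK.
by case: notfirst; rewrite -Ep -Eq tP tR.
Qed.

Lemma is_BL_swap_word t p q : is_BL t -> descent (std t) (p, q) ->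
  is_BL (swap_word t p q).
Proof.
move=> BLt; rewrite descent_std => /andP[/eqP pq tqp].
by apply: is_BL_swap => // -[Eq _]; move: tqp; rewrite Eq ltnNge leqnSn.
Qed.

Definition BL_rank x : nat := \sum_i inv_code (std (val x)) i.

Lemma BL_stepP x y : reflect
  (exists2 pq, descent (std (val y)) pq & val x = swap_word (val y) pq.1 pq.2)
  (BL_step x y).
Proof.
apply: (iffP existsP) => [[p /existsP[q /and3P[pq ltx /eqP Ey]]]|[[p q] dsc Ex]].
  have {}Ey : val y = swap_word (val x) p q by [].
  have Ex : val x = swap_word (val y) p q by rewrite Ey swap_wordK.
  exists (p, q) => //; rewrite descent_std pq /=.
  by rewrite Ey !tnth_mktuple tpermL tpermR.
exists p; apply/existsP; exists q; move: dsc; rewrite descent_std => /andP[-> tqp].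
apply/and3P; split=> //; first by rewrite Ex !tnth_mktuple tpermL tpermR.
by rewrite Ex; apply/eqP/esym/swap_wordK.
Qed.

Lemma BL_rank_step x y : BL_step x y -> BL_rank y = (BL_rank x).+1.
Proof.
case/BL_stepP=> -[p q] dsc Ex.
rewrite /BL_rank Ex std_swap_word //= sum_inv_code_descent // prednK //.
by rewrite (bigD1 q) //= ltn_addr // (leq_ltn_trans _ (inv_code_descent dsc)).
Qed.

Lemma BL_le_rank x y : BL_le x y ->
  x = y \/ exists2 z, BL_step x z & BL_le z y /\ BL_rank x < BL_rank y.
Proof.
case/connectP=> s; elim: s x => [|z s IH] x /=; first by move=> _ ->; left.
case/andP=> xz zs Ey; right; exists z => //; split.
  by apply/connectP; exists s.
rewrite -(BL_rank_step xz); case: (IH z zs Ey) => [->//|[_ _ [_]]]; exact: ltnW.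
Qed.

Lemma BL_rank_strict x y : strict (@BL_le n m) x y -> BL_rank x < BL_rank y.
Proof.
by case/andP=> nxy /BL_le_rank[exy|[z _ []//]]; rewrite exy eqxx in nxy.
Qed.

Lemma BL_le_anti : antisymmetric (@BL_le n m).
Proof.
move=> x y /andP[xy yx]; apply/eqP/negPn/negP => nxy.
have := @BL_rank_strict x y; have := @BL_rank_strict y x.
rewrite /strict xy yx eq_sym nxy => /(_ isT) h1 /(_ isT) h2.
by have := ltn_trans h1 h2; rewrite ltnn.
Qed.

(** A step raises the rank by exactly one, which leaves no room for an element strictly in
    between. *)
Lemma BL_covered_by x y : covered_by (@BL_le n m) x y = BL_step x y.
Proof.
apply/andP/idP => [[/andP[nxy xy] noz]|xy].
  case: (BL_le_rank xy) => [exy|[z xz [zy _]]]; first by rewrite exy eqxx in nxy.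
  have [<-//|nzy] := eqVneq z y.
  case/negP: noz; apply/existsP; exists z; rewrite /strict nzy zy (connect1 xz : BL_le x z) !andbT.
  by apply/eqP => exz; have := BL_rank_step xz; rewrite -exz; lia.
split; first rewrite /strict (connect1 xy : BL_le x y) andbT.
  by apply/eqP => exy; have := BL_rank_step xy; rewrite exy; lia.
apply/negP => /existsP[z /andP[/BL_rank_strict xz /BL_rank_strict zy]].
by have := BL_rank_step xy; lia.
Qed.

(** Rank 0 makes the standardization the identity, so the word is sorted, and its letter counts
    determine it. *)
Lemma BL_rank0_uniq x y : BL_rank x = 0 -> BL_rank y = 0 -> x = y.
Proof.
have sort0 z : BL_rank z = 0 -> sorted (fun i j : 'I_n => i <= j) (val z).
  move=> /eqP; rewrite sum_inv_code_eq0 => /eqP z1.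
  case: (posnP M) => [M0|M_gt0].
    have /size0nil -> // : size (val z) = 0 by rewrite size_tuple M0.
  apply/(sortedP (tnth (val z) (Ordinal M_gt0))) => k; rewrite size_tuple => ltk.
  have ltk' := ltnW ltk.
  have := ltn_std (val z) (Ordinal ltk') (Ordinal ltk).
  rewrite z1 !perm1 /= ltnSn /lex_lt -!(tnth_nth _ _ (Ordinal _)) => /esym/orP[/ltnW//|].
  by case/andP=> /eqP->.
move=> /sort0 sx /sort0 sy; apply/val_inj/val_inj.
apply: (sorted_eq _ _ sx sy).
- by move=> a b c; apply: leq_trans.
- by move=> a b /anti_leq/val_inj.
apply/allP => i _ /=; case/is_BLP: (valP x) => cx _; case/is_BLP: (valP y) => cy _.
by rewrite cx cy.
Qed.

Lemma BL_descend x : BL_rank x != 0 -> exists y, BL_step y x.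
Proof.
rewrite sum_inv_code_eq0 => /exists_descent[[p q] dsc].
exists (Sub (swap_word (val x) p q) (is_BL_swap_word (valP x) dsc)).
by apply/BL_stepP; exists (p, q).
Qed.

Lemma BL_bottom x : exists2 b, BL_rank b = 0 & BL_le b x.
Proof.
move Er : (BL_rank x) => r; elim: r x Er => [|r IH] x Er; first by exists x => //; apply: connect0.
have [|y yx] := @BL_descend x; first by rewrite Er.
have [|b b0 by_] := IH y; first by move: Er; rewrite (BL_rank_step yx) => -[].
by exists b => //; apply: connect_trans by_ (connect1 yx).
Qed.

(** The elements covered by x correspond to the descents of its standardization, so [num_saturated]
    and [num_walks] obey the same recursion. *)
Lemma num_saturated_walks b x : BL_rank b = 0 ->
  num_saturated (@BL_le n m) b x = num_walks (BL_rank x) (std (val x)).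
Proof.
move=> b0.
have le_b z : BL_le b z.
  by have [c c0 cz] := BL_bottom z; rewrite (BL_rank0_uniq b0 c0).
have le_refl : reflexive (@BL_le n m) by move=> z; apply: connect0.
have le_trans : transitive (@BL_le n m) by move=> z y w; apply: connect_trans.
move Er : (BL_rank x) => r; elim: r x Er => [|r IH] x Er.
  rewrite (BL_rank0_uniq Er b0) num_saturated_bot //; last exact: BL_le_anti.
  by move: b0 => /= /eqP; rewrite sum_inv_code_eq0 => ->.
have xb : x != b by apply/eqP => e; rewrite e b0 in Er.
rewrite (num_saturated_rec le_refl BL_le_anti le_trans BL_rank_strict xb).
rewrite (eq_bigl _ _ (fun y => BL_covered_by y x)) /=.
(* The default x of [insubd] is never taken at a descent, by [is_BL_swap_word]; [g] recovers the
   descent from the lower word. *)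
pose h (pq : 'I_M * 'I_M) : BL m := insubd x (swap_word (val x) pq.1 pq.2).
pose g y := [pick pq | descent (std (val x)) pq && (val y == swap_word (val x) pq.1 pq.2)].
have hE pq : descent (std (val x)) pq -> val (h pq) = swap_word (val x) pq.1 pq.2.
  by case: pq => p q dsc; rewrite /h val_insubd is_BL_swap_word //; apply: valP.
rewrite (reindex_omap h g) => [|y /BL_stepP[pq dsc Ey]]; last first.
  rewrite /g; case: pickP => [pq' /andP[dsc' /eqP Ey']|/(_ pq)]; last by rewrite dsc Ey eqxx.
  by congr Some; apply: val_inj; rewrite hE.
apply: eq_big => [pq|pq /andP[step /eqP gh]].
  apply/andP/idP => [[_]|dsc].
    by rewrite /g; case: pickP => // pq' /andP[dsc' _] /eqP[<-].
  split; first by apply/BL_stepP; exists pq; rewrite ?hE.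
  rewrite /g; case: pickP => [pq' /andP[dsc' /eqP Eh]|/(_ pq)]; last by rewrite dsc hE // eqxx.
  (* Equal words have equal standardizations; cancelling [std (val x)] leaves two equal adjacent
     transpositions. *)
  apply/eqP; congr Some; case: pq pq' dsc dsc' Eh => p q [p' q'] dsc dsc'.
  rewrite hE //= => /(congr1 (@std _ _)); rewrite !std_swap_word // => /mulIg.
  move=> e; symmetry; apply: tperm_adj_inj e.
    by case/andP: dsc => /eqP.
  by case/andP: dsc' => /eqP.
have dsc : descent (std (val x)) pq.
  by move: gh; rewrite /g; case: pickP => // pq' /andP[dsc _] [<-].
rewrite IH ?hE //; last by have := BL_rank_step step; rewrite Er => -[].
by case: pq dsc {gh step} => p q dsc; rewrite std_swap_word.
Qed.

End BLPoset.

(** * The maximum of BL(m) *)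

Section TopWord.
Variables (n : nat) (m : 'I_n -> nat) (m_gt0 : forall i, 0 < m i).
Notation M := (mult_size m).
Implicit Types (t : word m) (p q : 'I_M) (x y : BL m) (i j : 'I_n).

Definition top_tail : seq 'I_n :=
  flatten [seq nseq (m i).-1 i | i <- rev (enum 'I_n)].

Definition top_seq : seq 'I_n := enum 'I_n ++ top_tail.

(** The values of [std] as a list, with [pre] the part of the word already read; in this form the
    word can be compared with [beta_line] block by block. *)
Fixpoint standardize (pre s : seq 'I_n) : seq nat :=
  if s is i :: s' then
    psum m i + count_mem i pre :: standardize (rcons pre i) s'
  else [::].

Lemma size_standardize pre s : size (standardize pre s) = size s.
Proof. by elim: s pre => //= i s IH pre; rewrite IH. Qed.

Lemma standardize_cat pre s1 s2 :
  standardize pre (s1 ++ s2) = standardize pre s1 ++ standardize (pre ++ s1) s2.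
Proof.
elim: s1 pre => [|i s1 IH] pre /=; first by rewrite cats0.
by rewrite IH cat_rcons.
Qed.

Lemma nth_standardize i0 pre s (p : nat) : p < size s ->
  nth 0 (standardize pre s) p
    = psum m (nth i0 s p) + count_mem (nth i0 s p) (pre ++ take p s).
Proof.
elim: s pre p => // i s IH pre [|p] /=; first by rewrite cats0.
by rewrite ltnS => /IH->; rewrite cat_rcons.
Qed.

Lemma standardize_nseq pre k i :
  standardize pre (nseq k i) = iota (psum m i + count_mem i pre) k.
Proof.
elim: k pre => //= k IH pre; rewrite IH; congr (_ :: iota _ _).
by rewrite -cats1 count_cat /= eqxx addn0 addn1 addnS.
Qed.

Lemma standardize_uniq pre s : uniq s -> {in s, forall i, count_mem i pre = 0} ->
  standardize pre s = [seq psum m i | i : 'I_n <- s].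
Proof.
elim: s pre => //= i s IH pre /andP[nis us] pre0; rewrite pre0 ?mem_head // addn0.
rewrite IH // => j js; rewrite -cats1 count_cat /= pre0 ?inE ?js ?orbT //.
by case: eqP nis => // ->; rewrite js.
Qed.

Lemma standardize_flatten pre s : uniq s -> {in s, forall i, count_mem i pre = 1} ->
  standardize pre (flatten [seq nseq (m i).-1 i | i <- s])
    = flatten [seq iota (psum m i).+1 (m i).-1 | i : 'I_n <- s].
Proof.
elim: s pre => //= i s IH pre /andP[nis us] pre1.
rewrite standardize_cat standardize_nseq pre1 ?mem_head // addn1 IH // => j js.
rewrite count_cat pre1 ?inE ?js ?orbT // count_nseq /=.
by case: eqP nis => // ->; rewrite js.
Qed.

Lemma beta_line_standardize : beta_line m = standardize [::] top_seq.
Proof.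
rewrite standardize_cat standardize_uniq ?enum_uniq // cat0s.
rewrite standardize_flatten ?rev_uniq ?enum_uniq // => i _.
by rewrite count_uniq_mem ?enum_uniq ?mem_enum.
Qed.

Lemma size_top_seq : size top_seq == M.
Proof.
by rewrite -(size_standardize [::]) -beta_line_standardize size_beta_line.
Qed.

Definition top_word : word m := Tuple size_top_seq.

Lemma count_top_seq i : count_mem i top_seq = m i.
Proof.
rewrite count_cat count_uniq_mem ?enum_uniq // mem_enum count_flatten -map_comp.
rewrite sumnE big_map big_rev /= big_enum /= (bigD1 i) //= count_nseq /= eqxx mul1n.
rewrite big1 ?addn0 ?add1n ?prednK // => j ji.
by rewrite count_nseq /= (negPf ji).
Qed.

Lemma index_top_seq i : index i top_seq = i.
Proof. by rewrite index_cat mem_enum index_enum_ord. Qed.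

Lemma top_word_BL : is_BL top_word.
Proof.
apply/is_BLP; split=> [i|i j ij]; first exact: count_top_seq.
by rewrite !index_top_seq ij.
Qed.

Definition top : BL m := Sub top_word top_word_BL.

Lemma pairwise_top_tail : pairwise (fun i j : 'I_n => j <= i) top_tail.
Proof.
have: pairwise (fun i j : 'I_n => j <= i) (rev (enum 'I_n)).
  rewrite -sorted_pairwise => [|a b c ba ac]; last exact: leq_trans ac ba.
  rewrite rev_sorted; have := iota_ltn_sorted 0 n.
  by rewrite -val_enum_ord sorted_map; apply: sub_sorted => a b /ltnW.
rewrite /top_tail; elim: (rev _) => //= i s IH /andP[/allP les /IH{}IH].
rewrite pairwise_cat IH andbT; apply/andP; split.
  apply/allrelP => a b; rewrite mem_nseq => /andP[_ /eqP->].
  by case/flatten_mapP => c cs; rewrite mem_nseq => /andP[_ /eqP->]; apply: les.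
by elim: ((m i).-1) => //= k ->; rewrite andbT all_nseq leqnn orbT.
Qed.

Lemma tnth_top_head p : p < n -> tnth top_word p = p :> nat.
Proof.
move=> pn; rewrite (tnth_nth (Ordinal pn)) nth_cat size_enum_ord pn.
by rewrite nth_enum_ord.
Qed.

Lemma tnth_top_tail p q : n <= p -> p <= q -> tnth top_word q <= tnth top_word p.
Proof.
move=> np; rewrite leq_eqVlt => /orP[/eqP/val_inj->//|pq].
have i0 := tnth top_word p.
have szE : n + size top_tail = M by rewrite -(eqP size_top_seq) size_cat size_enum_ord.
rewrite !(tnth_nth i0) !nth_cat size_enum_ord !ltnNge np (leq_trans np (ltnW pq)) /=.
have [ltp ltq] := (ltn_ord p, ltn_ord q).
have nq := leq_trans np (ltnW pq).
have /(pairwiseP i0) := pairwise_top_tail; apply; rewrite ?inE.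
- by rewrite ltn_subLR // szE.
- by rewrite ltn_subLR // szE.
by rewrite ltn_sub2rE.
Qed.

(** The first n letters increase, so the smaller value at b lies in the tail; from there on the
    letters weakly decrease and stay below the letter at a. *)
Lemma std_top_avoids213 : strictly_avoids213 (std top_word).
Proof.
move=> a b c ab bc; rewrite ltn_std /lex_lt.
have [ba|_] := ltnP b a; first by have := ltn_trans ab ba; rewrite ltnn.
rewrite andbF orbF => tba; have [bn|nb] := ltnP b n.
  by move: tba; rewrite !tnth_top_head ?(ltn_trans ab) // => /(ltn_trans ab); rewrite ltnn.
apply: ltnW; rewrite ltn_std /lex_lt.
by rewrite (leq_ltn_trans (tnth_top_tail nb (ltnW bc)) tba).
Qed.

Lemma leq_psum k l : k <= l -> psum m k <= psum m l.
Proof.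
move=> kl; rewrite /psum big_mkcond [leqRHS]big_mkcond; apply: leq_sum => i _.
by case: ifP => // ik; rewrite (leq_trans ik kl).
Qed.

(** By [std_uniq] it suffices to compare orders: different letters take their values in disjoint
    consecutive blocks, and within a block values grow with the position. *)
Lemma std_top : std top_word = beta m_gt0.
Proof.
symmetry; apply: std_uniq => p q; rewrite !permE /=.
have bE (r : 'I_M) : nth 0 (beta_line m) r
    = psum m (tnth top_word r) + count_mem (tnth top_word r) (take r top_seq).
  have i0 := tnth top_word r.
  rewrite beta_line_standardize (nth_standardize i0) ?(eqP size_top_seq) //.
  by rewrite (tnth_nth i0).
have lt_count (a b : 'I_M) : a < b -> tnth top_word a = tnth top_word b ->
    count_mem (tnth top_word a) (take a top_seq)
    < count_mem (tnth top_word b) (take b top_seq).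
  move=> ab Et; have i0 := tnth top_word a.
  rewrite -(cat_take_drop a.+1 (take b top_seq)) take_takel // count_cat.
  rewrite (take_nth i0) ?(eqP size_top_seq) // -cats1 count_cat /= -Et.
  by rewrite (tnth_nth i0) eqxx addn0 addn1 ltnS leq_addr.
have lt_block (a b : 'I_M) : tnth top_word a < tnth top_word b ->
    nth 0 (beta_line m) a < nth 0 (beta_line m) b.
  move=> tab; rewrite !bE; apply: leq_trans (leq_addr _ _).
  apply: leq_trans (leq_psum tab); rewrite psumS ltn_add2l.
  rewrite -[X in _ < X]count_top_seq -[X in _ < count _ X](cat_take_drop a) count_cat.
  have i0 := tnth top_word a.
  rewrite (drop_nth i0) ?(eqP size_top_seq) //= (tnth_nth i0) eqxx.
  by rewrite -[X in X < _]addn0 ltn_add2l.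
rewrite /lex_lt; case: (ltngtP (tnth top_word p) (tnth top_word q)) => [pq|qp|/val_inj Et].
- by rewrite lt_block.
- have ba := lt_block _ _ qp; rewrite -val_eqE gtn_eqF //=.
  by apply/negP => ab; have := ltn_trans ab ba; rewrite ltnn.
rewrite Et eqxx /=; rewrite !bE Et ltn_add2l.
case: (ltngtP p q) => [pq|qp|/val_inj->]; last by rewrite ltnn.
  by rewrite -{1}Et lt_count.
apply/negP => pq; have := lt_count _ _ qp (esym Et).
by rewrite Et => /(ltn_trans pq); rewrite ltnn.
Qed.

Lemma BL_index_homo t i j : is_BL t -> i < j -> index i t < index j t.
Proof.
case/is_BLP=> _ idx; move Ek : (j - i).-1 => k.
elim: k j Ek => [|k IH] j Ek ij; first by apply: idx; lia.
have ltj : j.-1 < n by apply: leq_ltn_trans (leq_pred j) (ltn_ord j).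
by apply: ltn_trans (IH (Ordinal ltj) _ _) (idx _ _ _) => /=; lia.
Qed.

(** An ascent that cannot be swapped must be blocked by the condition on first occurrences, and
    [is_BL_swap] leaves only this way. *)
Lemma local_max_ascent x p q : (forall y, ~~ BL_step x y) -> q = p.+1 :> nat ->
  tnth (val x) p < tnth (val x) q ->
  tnth (val x) q = (tnth (val x) p).+1 :> nat /\ index (tnth (val x) p) (val x) = p.
Proof.
move=> maxx pq ltx.
have [/andP[/eqP-> /eqP->]//|nfirst] := boolP
  ((tnth (val x) q == (tnth (val x) p).+1 :> nat) && (index (tnth (val x) p) (val x) == p)).
have BLs : is_BL (swap_word (val x) p q).
  by apply: is_BL_swap => // [|[e1 e2]]; [apply: valP | rewrite e1 e2 !eqxx in nfirst].
have /negP[] := maxx (Sub (swap_word (val x) p q) BLs).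
apply/existsP; exists p; apply/existsP; exists q.
by rewrite pq eqxx ltx SubK eqxx.
Qed.

(** Strong induction on the letter. Just before the first i there is neither i nor a larger letter,
    whose first occurrence comes later; so there is an ascent, and by [local_max_ascent] it starts
    at the first occurrence of the preceding letter. *)
Lemma local_max_index x i : (forall y, ~~ BL_step x y) -> index i (val x) = i.
Proof.
move=> maxx; have BLx : is_BL (val x) := valP x.
move Ek : (nat_of_ord i) => k; elim/ltn_ind: k i Ek => k IH i Ek.
have [Q EQ tQ] := BL_letterP (mem_BL m_gt0 i BLx).
have [Q0|Q_gt0] := posnP Q.
  rewrite -EQ Q0 -Ek; case: (posnP i) => [->//|i_gt0].
  have i1 : i.-1 < n by apply: leq_ltn_trans (leq_pred i) (ltn_ord i).
  by have := @BL_index_homo (val x) (Ordinal i1) i BLx; rewrite -EQ Q0 /=; lia.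
have ltp : Q.-1 < M by apply: leq_ltn_trans (leq_pred Q) (ltn_ord Q).
pose p := Ordinal ltp; have pQ : Q = p.+1 :> nat by rewrite /= prednK.
have := index_tnth (val x) p; case: (ltngtP (tnth (val x) p) i) => [lt_pi|lt_ip|e].
- have := local_max_ascent maxx pQ; rewrite tQ => /(_ lt_pi) [Ei Ep] _.
  have tk : tnth (val x) p < k by rewrite -Ek.
  by rewrite -EQ pQ -Ep (IH _ tk (tnth (val x) p) erefl) -Ek Ei.
- by have := BL_index_homo BLx lt_ip; rewrite -EQ pQ => lt1 /(leq_trans lt1); lia.
by rewrite (val_inj e) -EQ pQ ltnn.
Qed.

(** First occurrences fill the first n positions in order. An ascent further on would start at a
    first occurrence, so the rest is weakly decreasing and determined by its letter counts. *)
Lemma local_max_top x : (forall y, ~~ BL_step x y) -> x = top.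
Proof.
move=> maxx; have idx i := local_max_index i maxx.
have BLx : is_BL (val x) := valP x; have /is_BLP[cnt _] := BLx.
apply/val_inj/val_inj => /=; set s := tval (val x).
have szs : size s = M by rewrite size_tuple.
case Es : s => [|i0 s']; first by apply/esym/size0nil; rewrite (eqP size_top_seq) -szs Es.
rewrite -Es {s' Es}.
have nM : n <= M.
  case: (posnP n) => [n0|n_gt0]; first by apply: (@leq_trans 0); rewrite ?n0.
  have ltn1 : n.-1 < n by rewrite prednK.
  have := mem_BL m_gt0 (Ordinal ltn1) BLx; rewrite -index_mem idx size_tuple /=.
  by rewrite prednK.
have head : take n s = enum 'I_n.
  apply: (@eq_from_nth _ i0) => [|k]; first by rewrite size_takel ?szs // size_enum_ord.
  rewrite size_takel ?szs // => ltk; rewrite nth_take //.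
  have := nth_index i0 (mem_BL m_gt0 (Ordinal ltk) BLx); rewrite idx /= => ->.
  by apply: val_inj; rewrite /= nth_enum_ord.
have tail : sorted (fun i j : 'I_n => j <= i) (drop n s).
  apply/(sortedP i0) => k; rewrite size_drop szs ltn_subRL addnS => ltk.
  rewrite !nth_drop addnS leqNgt; apply/negP => lt_asc.
  have := @local_max_ascent x (Ordinal (ltnW ltk)) (Ordinal ltk) maxx erefl.
  rewrite !(tnth_nth i0) /= => /(_ lt_asc) [_]; rewrite idx => e.
  by have := ltn_ord (nth i0 s (n + k)); rewrite /s e; lia.
rewrite -(cat_take_drop n s) head /top_seq; congr (_ ++ _).
apply: (sorted_eq _ _ tail).
- by move=> a b c ba ac; apply: leq_trans ac ba.
- by move=> a b /anti_leq/val_inj.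
- by rewrite sorted_pairwise ?pairwise_top_tail // => a b c ba ac; apply: leq_trans ac ba.
rewrite -(perm_cat2l (enum 'I_n)) -{1}head cat_take_drop.
by apply/allP => i _ /=; rewrite cnt count_top_seq.
Qed.

(** Steps upwards raise the bounded rank, so climbing from x stops at a word without upward steps,
    which is [top]. *)
Lemma BL_top x : BL_le x top.
Proof.
pose K := \max_(y : BL m) BL_rank y; have leK y : BL_rank y <= K by apply: leq_bigmax.
move Ek : (K - BL_rank x) => k.
elim/ltn_ind: k x Ek => k IH x Ek.
have [y xy|nostep] := pickP (BL_step x); last first.
  by rewrite (@local_max_top x) => [|y]; [apply: connect0 | rewrite nostep].
apply: connect_trans (connect1 xy) (IH _ _ y erefl).
by have := BL_rank_step xy; have := leK y; rewrite -Ek; lia.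
Qed.

End TopWord.

(** * Frobenius' formula as the hook formula, and the number of maximal chains *)

Lemma code_count_hooks N (w : 'S_N) : monotone_code w ->
  (code_count (inv_code w) = (sumn (code_partition w))`!%:R
    / (\prod_(c <- cells (code_partition w)) hook_length (code_partition w) c)%:R)%R.
Proof.
move=> mono; pose cs := [seq inv_code w i | i : 'I_N].
have sz_cs : size cs = N by rewrite size_map size_enum_ord.
have nth_cs (i : 'I_N) : nth 0 cs i = inv_code w i.
  by rewrite (nth_map i) ?size_enum_ord // nth_ord_enum.
have srt : sorted leq cs.
  apply/(sortedP 0) => k; rewrite sz_cs => ltk.
  by rewrite (nth_cs (Ordinal (ltnW ltk))) (nth_cs (Ordinal ltk)) mono.
have laE : code_partition w = rev [seq r <- cs | 0 < r].
  apply: (sorted_eq (leT := geq)).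
  - by move=> a b c ba ac; apply: leq_trans ac ba.
  - by move=> a b; rewrite andbC => /anti_leq.
  - by apply: sort_sorted => a b; apply: leq_total.
  - by rewrite rev_sorted; apply: sorted_filter srt => a b c; apply: leq_trans.
  by rewrite perm_sort perm_sym perm_rev.
have sumE : sumn (code_partition w) = \sum_i inv_code w i.
  rewrite laE sumn_rev sumnE big_filter big_mkcond big_map big_enum /=.
  by apply: eq_bigr => i _; case: posnP.
rewrite sumE prod_hook_length laE hook_product_rev_pos /code_count ffact_det_prod.
have := hook_product_Vandermonde srt; rewrite sz_cs => HV.
set V := (\prod_(i < N) _)%R; set P := \prod_(i < N) _.
(* Monotonicity of the code keeps the subtractions of natural numbers from truncating. *)
have VE : V = (\prod_(k < N) \prod_(i < k) (nth 0 cs k + k - (nth 0 cs i + i)))%:R%R.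
  rewrite natr_prod /V (exchange_big_dep predT) //=; apply: eq_bigr => k _.
  rewrite (big_ord_widen N (fun i => nth 0 cs k + k - (nth 0 cs i + i))); last exact: ltnW.
  rewrite natr_prod; apply: eq_bigr => i ik; rewrite natrB !nth_cs //.
  apply: leq_add (ltnW ik); rewrite -!nth_cs.
  by apply: (sorted_leq_nth leq_trans leqnn 0 srt) (ltnW ik); rewrite inE sz_cs.
have PE : P = \prod_(k < N) (nth 0 cs k + k)`!.
  by apply: eq_bigr => i _; rewrite nth_cs.
have : (P%:R != 0 :> rat)%R by rewrite pnatr_eq0 -lt0n prodn_gt0 // => i; apply: fact_gt0.
rewrite PE -HV natrM -VE mulf_eq0 negb_or => /andP[H0 V0].
by field; rewrite H0 V0.
Qed.

Theorem theorem5p1 (n : nat) (m : 'I_n -> nat) (m_gt0 : forall i, 0 < m i) :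
  let la := code_partition (beta m_gt0) in
  (#|[set C : {set BL m} | maximal_chain (@BL_le n m) C]|%:R
    = (sumn la)`!%:R / (\prod_(c <- cells la) hook_length la c)%:R :> rat)%R.
Proof.
move=> la.
have [b b0 _] := BL_bottom m_gt0 (top m_gt0).
have le_b z : BL_le b z.
  by have [c c0 cz] := BL_bottom m_gt0 z; rewrite (BL_rank0_uniq b0 c0).
have -> : #|[set C : {set BL m} | maximal_chain (@BL_le n m) C]|
    = num_saturated (@BL_le n m) b (top m_gt0).
  apply: eq_card => C; rewrite !inE.
  by apply: maximal_chain_saturated => //; [apply: BL_le_anti | apply: BL_top].
have mono := avoids213_monotone_code (@std_top_avoids213 n m m_gt0).
rewrite num_saturated_walks // num_walks_code // eqxx std_top.
by apply: code_count_hooks; rewrite -std_top.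
Qed.
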